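(* Let $x\in M$ and let $o\in O_M\subset E$ be the point of the zero section with $\pi(o)=x$. Then the Riemannian curvature tensor of $\mathrm{g}_{M,E}$ satisfies at the point $o$, for all tangent vectors $X,Y,Z,W\in T_oE$: \begin{align*} R_o(X^h,Y^h,Z^h,W^h)&=e^{2\varphi_1}\langle\pi^*R^M_x(X^h,Y^h)Z^h,W^h\rangle_M\\ R_o(X^h,Y^h,Z^h,W^v)&=0\\ R_o(X^h,Y^h,Z^v,W^v)&=e^{2\varphi_2}\langle\pi^\star R^E_x(X^h,Y^h)Z^v,W^v\rangle_E\\ R_o(X^h,Y^v,Z^h,W^v)&=a\,e^{2\varphi_1}\langle X^h,Z^h\rangle_M\langle Y^v,W^v\rangle_E+\tfrac12e^{2\varphi_2}\langle\pi^\star R^E_x(X^h,Z^h)Y^v,W^v\rangle_E\\ R_o(X^v,Y^v,Z^h,W^h)&=e^{2\varphi_2}\langle\pi^\star R^E_x(Z^h,W^h)X^v,Y^v\rangle_E\\ R_o(X^v,Y^v,Z^v,W^h)&=0\\ R_o(X^h,Y^v,Z^v,W^v)&=0\\ R_o(X^v,Y^v,Z^v,W^v)&=-2b\,e^{2\varphi_2}\bigl(\langle X^v,W^v\rangle_E\langle Y^v,Z^v\rangle_E-\langle X^v,Z^v\rangle_E\langle Y^v,W^v\rangle_E\bigr), \end{align*} where $a=2\varphi_1'(0)$, $b=2\varphi_2'(0)$ and $\varphi_1,\varphi_2$ are evaluated at $r=0$.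
   Context: $(M,g_M)$ is a Riemannian manifold with Levi-Civita connection $\nabla^M$ and curvature $R^M$; $\pi:E\to M$ is a real vector bundle of rank $k$ with a fibre metric $g_E$ and a compatible connection $D^E$ ($D^Eg_E=0$) with curvature $R^E$. The vertical bundle $\ker d\pi\subset TE$ is identified with the pull-back $\pi^\star E$; the connection $D^E$ determines a horizontal complement, identified through $d\pi$ with the pull-back $\pi^*TM$, so $TE\simeq\pi^*TM\oplus\pi^\star E$ and every tangent vector decomposes as $X=X^h+X^v$. (Both $\pi^*$ and $\pi^\star$ denote ordinary pull-back by $\pi$; the star distinguishes horizontal and vertical copies.) Write $\langle X,Y\rangle_M=(\pi^*g_M)(X^h,Y^h)$ and $\langle X,Y\rangle_E=(\pi^\star g_E)(X^v,Y^v)$. $O_M\subset E$ is the zero section. Let $r(e)=\|e\|_E^2$ and let $\varphi_1,\varphi_2$ be functions of $r$ only, smooth for $r\ge0$ (smooth on the right at $r=0$); the prime is the derivative in $r$. The metric on the manifold $E$ is $$\mathrm{g}_{M,E}=e^{2\varphi_1}\pi^*g_M\oplus e^{2\varphi_2}\pi^\star g_E .$$ $R(X,Y,Z,W)=\mathrm{g}_{M,E}(R(X,Y)Z,W)$, where $R(X,Y)Z=\nabla_X\nabla_YZ-\nabla_Y\nabla_XZ-\nabla_{[X,Y]}Z$ and $\nabla$ is the Levi-Civita connection of $\mathrm{g}_{M,E}$; the same sign convention is used for $R^M$ and $R^E$. *)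

(* Defs.v *)
From HB Require Import structures.
From mathcomp Require Import all_boot all_order all_algebra.
From mathcomp Require Import all_classical all_reals all_analysis.

Set Implicit Arguments.
Unset Strict Implicit.
Unset Printing Implicit Defensive.

Import Order.TTheory GRing.Theory Num.Theory.
Import numFieldNormedType.Exports.

Local Open Scope classical_set_scope.
Local Open Scope ring_scope.

(** * Smooth functions *)

(* [U] is meant to be open. For maps between finite-dimensional spaces, this is
   the usual notion: the differential exists and is itself C^k. *)
Fixpoint Ck_on {R : realType} {n : nat} {W : normedModType R} (k : nat)
    (U : set 'rV[R]_n) (f : 'rV[R]_n -> W) : Prop :=
  match k with
  | 0%N => forall x, U x -> {for x, continuous f}
  | k'.+1 => (forall x, U x -> differentiable f x) /\
             (forall v, Ck_on k' U (fun x => 'd f x v))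
  end.

Definition smooth_on {R : realType} {n : nat} {W : normedModType R}
    (U : set 'rV[R]_n) (f : 'rV[R]_n -> W) : Prop :=
  forall k, Ck_on k U f.

(* Functions on the half-line [r >= 0]. The values of [f] at negative arguments
   play no role; at [r = 0] the derivative is the right derivative. *)
Definition dquot {R : realType} (f : R -> R) (r : R) : R -> R :=
  fun s => (f s - f r) / (s - r).

Definition hderive {R : realType} (f : R -> R) (r : R) : R :=
  lim (dquot f r s @[s --> within [set s | 0 <= s] r^']).

Definition hsmooth {R : realType} (f : R -> R) : Prop :=
  forall (j : nat) (r : R), 0 <= r ->
    cvg (dquot (iter j hderive f) r s @[s --> within [set s | 0 <= s] r^']).

(** * Manifolds *)

(* The values of [cmap] outside [cdom], and of [cinv] outside the image of
   [cdom], are irrelevant. *)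
Record chart (R : realType) (n : nat) (T : topologicalType) := Chart {
  cdom : set T ;
  cmap : T -> 'rV[R]_n ;
  cinv : 'rV[R]_n -> T }.

Definition cimg {R : realType} {n : nat} {T : topologicalType}
    (c : chart R n T) (U : set T) : set 'rV[R]_n :=
  cmap c @` (U `&` cdom c).

Definition is_chart {R : realType} {n : nat} {T : topologicalType}
    (c : chart R n T) : Prop :=
  [/\ open (cdom c),
      open (cimg c setT),
      forall p, cdom c p -> cinv c (cmap c p) = p,
      {within cdom c, continuous (cmap c)} &
      {within cimg c setT, continuous (cinv c)}].

Definition smooth_transition {R : realType} {n : nat} {T : topologicalType}
    (c d : chart R n T) : Prop :=
  smooth_on (cimg c (cdom d)) (cmap d \o cinv c).

(* [mchart p] is a preferred chart around [p], used below to represent the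
   tangent space at [p]. *)
Record manifold (R : realType) (n : nat) := Manifold {
  mpoint :> topologicalType ;
  m_hausdorff : hausdorff_space mpoint ;
  m_countable : @second_countable mpoint ;
  atlas : set (chart R n mpoint) ;
  atlas_chart : forall c, atlas c -> is_chart c ;
  atlas_smooth : forall c d, atlas c -> atlas d -> smooth_transition c d ;
  atlas_maximal : forall c, is_chart c ->
    (forall d, atlas d -> smooth_transition c d /\ smooth_transition d c) ->
    atlas c ;
  mchart : mpoint -> chart R n mpoint ;
  mchart_atlas : forall p, atlas (mchart p) ;
  mchart_dom : forall p, cdom (mchart p) p }.

Section Tangent.
Context {R : realType} {n : nat} {M : manifold R n}.

Definition msmooth {W : normedModType R} (U : set M) (f : M -> W) : Prop :=
  forall c, atlas c -> smooth_on (cimg c U) (f \o cinv c).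

(* A tangent vector at [p] is represented by its components in the chart
   [mchart p]. *)
Definition tangent (p : M) : normedModType R := 'rV[R]_n.

Definition mdiff {W : normedModType R} (f : M -> W) (p : M) (v : tangent p) : W :=
  'd (f \o cinv (mchart p)) (cmap (mchart p) p) v.

(* Components in an arbitrary chart [c] around [p]. *)
Definition tcoord (c : chart R n M) (p : M) (v : tangent p) : 'rV[R]_n :=
  mdiff (cmap c) v.

Definition vfield : Type := forall p : M, tangent p.

Definition vf_coord (X : vfield) (c : chart R n M) : 'rV[R]_n -> 'rV[R]_n :=
  fun y => tcoord c (X (cinv c y)).

Definition vf_smooth (U : set M) (X : vfield) : Prop :=
  forall c, atlas c -> smooth_on (cimg c U) (vf_coord X c).

Definition lie (X Y : vfield) : vfield := fun p =>
  let c := mchart p in let y := cmap c p in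
  ('d (vf_coord Y c) y (vf_coord X c y) - 'd (vf_coord X c) y (vf_coord Y c y)
    : 'rV[R]_n).

End Tangent.
Arguments vfield {R n} M.

(* Tangent map of [f] at [p]. *)
Definition tmap {R : realType} {m n : nat} {M : manifold R m} {N : manifold R n}
    (f : M -> N) (p : M) (v : tangent p) : tangent (f p) :=
  mdiff (cmap (mchart (f p)) \o f) v.

(* Velocity at time 0. *)
Definition velocity {R : realType} {n : nat} {M : manifold R n} (g : R -> M) :
    tangent (g 0) :=
  derive1 (cmap (mchart (g 0)) \o g) 0.

(** * Metrics, connections and curvature *)

(* A family of vector spaces over [M] together with the notion of a section
   being smooth on an open set, so that tangent bundles and arbitrary vector
   bundles are treated at once. Local sections are represented by total
   functions, of which only the germ at the point considered matters. *)
Record vfamily {R : realType} {n : nat} (M : manifold R n) := VFamily {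
  vfib :> M -> lmodType R ;
  ssmooth : set M -> (forall x, vfib x) -> Prop }.

Definition tangent_family {R : realType} {n : nat} (M : manifold R n) :
    vfamily M :=
  VFamily (vfib := fun p => tangent p : lmodType R) vf_smooth.

Section Families.
Context {R : realType} {n : nat} {M : manifold R n} (V : vfamily M).

Definition section : Type := forall x, V x.

Definition smooth_near (p : M) (s : section) : Prop :=
  exists2 U, open_nbhs p U & ssmooth U s.

Definition is_metric (g : forall x, V x -> V x -> R) : Prop :=
  [/\ forall x u v, g x u v = g x v u,
      forall x a u v w, g x (a *: u + v) w = a * g x u w + g x v w,
      forall x u, u != 0 -> 0 < g x u u &
      forall U s t, open U -> ssmooth U s -> ssmooth U t ->
        msmooth U (fun x => g x (s x) (t x) : R)].

Definition connection : Type := forall p : M, tangent p -> section -> V p.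

Record is_connection (D : connection) : Prop := {
  conn_linear : forall p a (v w : tangent p) s, smooth_near p s ->
    D p (a *: v + w) s = a *: D p v s + D p w s ;
  conn_add : forall p (v : tangent p) s t, smooth_near p s -> smooth_near p t ->
    D p v (fun x => s x + t x) = D p v s + D p v t ;
  conn_leibniz : forall p (v : tangent p) (f : M -> R) s,
    (exists2 U, open_nbhs p U & msmooth U f) -> smooth_near p s ->
    D p v (fun x => f x *: s x) = mdiff f v *: s p + f p *: D p v s ;
  conn_local : forall p (v : tangent p) s t, smooth_near p s -> smooth_near p t ->
    (\forall x \near p, s x = t x) -> D p v s = D p v t ;
  conn_smooth : forall U (X : vfield M) s, open U -> vf_smooth U X ->
    ssmooth U s -> ssmooth U (fun x => D x (X x) s) }.

Definition metric_compatible (g : forall x, V x -> V x -> R) (D : connection) :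
    Prop :=
  forall p (v : tangent p) s t, smooth_near p s -> smooth_near p t ->
    mdiff (fun x => g x (s x) (t x) : R) v
    = g p (D p v s) (t p) + g p (s p) (D p v t).

(* [Rm] is the curvature tensor of [D]. It is determined by [D], since tangent
   vectors and elements of the fibres extend to smooth local fields. *)
Definition is_curvature (D : connection)
    (Rm : forall p : M, tangent p -> tangent p -> V p -> V p) : Prop :=
  forall p (X Y : vfield M) (s : section),
    (exists2 U, open_nbhs p U & vf_smooth U X) ->
    (exists2 U, open_nbhs p U & vf_smooth U Y) ->
    smooth_near p s ->
    Rm p (X p) (Y p) (s p)
    = D p (X p) (fun q => D q (Y q) s) - D p (Y p) (fun q => D q (X q) s)
      - D p (lie X Y p) s.

End Families.

Definition torsion_free {R : realType} {n : nat} {M : manifold R n}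
    (D : connection (tangent_family M)) : Prop :=
  forall p (X Y : section (tangent_family M)),
    smooth_near p X -> smooth_near p Y ->
    D p (X p) Y - D p (Y p) X = lie X Y p.

Definition is_levi_civita {R : realType} {n : nat} {M : manifold R n}
    (g : forall x : M, tangent x -> tangent x -> R)
    (D : connection (tangent_family M)) : Prop :=
  [/\ is_connection D,
      @metric_compatible _ _ _ (tangent_family M) g D & torsion_free D].

(** * Vector bundles *)

Record ltriv (R : realType) (T : topologicalType) (F : T -> lmodType R)
    (k : nat) := LTriv {
  tdom : set T ;
  tcomp : forall x, F x -> 'rV[R]_k }.

(* The total space [E] is, as a set, the disjoint union of the fibres. A chart
   of [M] and a local trivialisation together give a chart of [E]; since atlases
   are maximal, this determines the manifold structure of [E]. *)
Record vbundle (R : realType) (n k : nat) (M : manifold R n) := VBundle {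
  fib : M -> lmodType R ;
  total_space : manifold R (n + k) ;
  pt : {x : M & fib x} -> total_space ;
  unpt : total_space -> {x : M & fib x} ;
  ptK : cancel pt unpt ;
  unptK : cancel unpt pt ;
  trivs : set (ltriv fib k) ;
  trivs_cover : forall x, exists2 t, trivs t & tdom t x ;
  trivs_open : forall t, trivs t -> open (tdom t) ;
  trivs_linear : forall t x, trivs t -> tdom t x -> linear (@tcomp _ _ _ _ t x) ;
  trivs_bij : forall t x, trivs t -> tdom t x -> bijective (@tcomp _ _ _ _ t x) ;
  trivs_chart : forall t (c : chart R n M), trivs t -> atlas c ->
    exists d : chart R (n + k) total_space,
      [/\ atlas d,
          cdom d = [set e | cdom c (tag (unpt e)) /\ tdom t (tag (unpt e))] &
          forall x (u : fib x), cdom c x -> tdom t x ->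
            cmap d (pt (existT _ x u)) = row_mx (cmap c x) (tcomp t u)] }.

Section Bundles.
Context {R : realType} {n k : nat} {M : manifold R n} (E : vbundle k M).

Definition base (e : total_space E) : M := tag (unpt e).

Definition fvec (e : total_space E) : fib E (base e) := tagged (unpt e).

Definition zero_section : set (total_space E) := [set e | fvec e = 0].

Definition sec_smooth (U : set M) (s : forall x, fib E x) : Prop :=
  forall (c : chart R n M) t, atlas c -> trivs t ->
    smooth_on (cimg c (U `&` tdom t)) (fun y => tcomp t (s (cinv c y))).

Definition bundle_family : vfamily M := VFamily sec_smooth.

(* The identification of the fibre over [base e] with the vertical subspace
   of the tangent space at [e]. *)
Definition vlift (e : total_space E) (w : fib E (base e)) : tangent e :=
  velocity (fun t : R => pt (existT (fib E) (base e) (fvec e + t *: w))).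

Variable D : connection bundle_family.

(* The horizontal subspace at [e]: tangent vectors of sections through [e] in
   directions in which they are parallel. *)
Definition horizontal (e : total_space E) : set (tangent e) :=
  [set xi | exists (v : tangent (base e)) (s : section bundle_family),
     [/\ smooth_near (base e) s, s (base e) = fvec e, D v s = 0 &
         xi = tmap (fun x => pt (existT (fib E) x (s x))) v]].

(* The vertical component, as an element of the fibre. *)
Definition vcomp (e : total_space E) (xi : tangent e) : fib E (base e) :=
  xget 0 [set w | horizontal (xi - vlift w : tangent e)].

Definition vpart (e : total_space E) (xi : tangent e) : tangent e :=
  vlift (vcomp xi).

Definition hpart (e : total_space E) (xi : tangent e) : tangent e :=
  xi - vpart xi.

(* The horizontal component, as a tangent vector of the base. *)
Definition hcomp (e : total_space E) (xi : tangent e) : tangent (base e) :=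
  tmap base (hpart xi).

Variable gM : forall x : M, tangent x -> tangent x -> R.
Variable gE : forall x : M, fib E x -> fib E x -> R.

Definition pairM (e : total_space E) (X Y : tangent e) : R :=
  gM (hcomp X) (hcomp Y).

Definition pairE (e : total_space E) (X Y : tangent e) : R :=
  gE (vcomp X) (vcomp Y).

Definition total_metric (phi1 phi2 : R -> R) (e : total_space E)
    (X Y : tangent e) : R :=
  let r := gE (fvec e) (fvec e) in
  expR (2 * phi1 r) * pairM X Y + expR (2 * phi2 r) * pairE X Y.

End Bundles.

(* Main.v *)
(* In a chart of [M] and a trivialisation of [E] the total space has coordinates (x, u),
   and a tangent vector a = (a1, a2) has vertical component P_a = a2 + A(a1)u, where A is
   the connection form of [DE]. Hence
     g(a, b) = f1(r) gM(a1, b1) + f2(r) gE(P_a, P_b),  f_i = exp(2 phi_i),  r = gE(u, u).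
   Let K(c, a; b) = (d_c g(a, b) + d_a g(c, b) - d_b g(c, a)) / 2 = g(nabla_c a, b) for
   coordinate fields. Because [DE] is metric, the derivative of g(a, b) can be written with
   gM, gE, A and dA only, and K(c, a; b) is the sum of f1 K^M, of f1' and f2' times terms
   that contain gE(P, u), and of
     f2/2 (gE(Q(c, a) + Q(a, c), P_b) + gE(P_a, RE(c1, b1)u) + gE(P_c, RE(a1, b1)u)),
   where Q(c, a) is the covariant derivative of P_a along c. Differentiating this once more
   at u = 0 and using
     g(R(e, c)a, b) = d_e K(c, a; b) - d_c K(e, a; b)
                      - g(nabla_c a, nabla_e b) + g(nabla_e a, nabla_c b)
   gives one formula for the whole curvature tensor, and the eight identities are its
   horizontal and vertical specialisations. Symmetry of second derivatives is used for the
   brackets of coordinate fields and for the skewness of RE. *)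

Require Import Defs.
From HB Require Import structures.
From mathcomp Require Import all_boot all_order all_algebra.
From mathcomp Require Import all_classical all_reals all_analysis.
From mathcomp Require Import ring lra.

Set Implicit Arguments.
Unset Strict Implicit.
Unset Printing Implicit Defensive.

Import Order.TTheory GRing.Theory Num.Theory.
Import numFieldNormedType.Exports.

Local Open Scope classical_set_scope.
Local Open Scope ring_scope.

(** * Differentiable and smooth maps *)

(** The connections and curvature tensors are hypotheses, specified only through their effect on
    smooth local fields. So [nabla] is reached only through its pairings with other vectors, and no
    metric is inverted. The Koszul identity is also applied to [M]: there it recombines the
    derivatives and products of base Christoffel terms into [RM], which therefore never needs a
    coordinate expression. The point of interest [r = 0] is the end of the half-line on which [phi1]
    and [phi2] are controlled. As [r = gE(u, u)] is nonnegative everywhere, a chain rule for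
    nonnegative inner functions replaces two-sided derivatives. At [u = 0] both [r] and its
    differential vanish, so no second derivative of [phi1] or [phi2] survives, and a factor
    [gE(P, u)] counts only through its own derivative; these factors produce [f1'(0) = a e1] and
    [f2'(0) = b e2]. Derivatives of [RE] drop because [RE] is applied to [u]. The 1/2 of the fourth
    identity is that of Koszul's formula; in the fifth, two such halves agree by skewness; the 2 of
    the last comes from antisymmetrising. *)

Section Differentials.
Context {R : realType}.
Implicit Types U V W : normedModType R.

Lemma linear_is_diff V W (f : V -> W) (x : V) :
  linear f -> continuous f -> is_diff x f f.
Proof.
move=> lf cf; pose fM := GRing.isLinear.Build _ _ _ _ _ lf.
pose F : {linear V -> W} := HB.pack f fM.
by apply: DiffDef; [exact: (@linear_differentiable _ _ _ F)|exact: (@diff_lin _ _ _ F)].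
Qed.

Lemma is_diffE V W (f df : V -> W) (x : V) :
  is_diff x f df -> forall v, 'd f x v = df v.
Proof. by move=> [_ E] v; rewrite E. Qed.

(** The point [y] is a separate variable: for transition maps, [f x] becomes the wanted point only
    after [cinv c (cmap c p)] is simplified. *)
Lemma is_diff_compose U V W (f df : U -> V) (g dg : V -> W) (x : U) (y : V) :
  f x = y -> is_diff x f df -> is_diff y g dg -> is_diff x (g \o f) (dg \o df).
Proof. by move=> <-; exact: is_diff_comp. Qed.

(** A first-order expansion depends only on the germ, and the continuous linear map in it is unique.
    Chart expressions match explicit formulas only near a point, so most later derivatives are
    transported by this lemma. *)
Lemma is_diff_near V W (f g df : V -> W) (x : V) :
  (\forall y \near x, f y = g y) -> is_diff x f df -> is_diff x g df.
Proof.
move=> fg dfx; have [dff dfE] := dfx.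
have E : g \o shift x = cst (g x) + 'd f x +o_ 0 id.
  apply/eqaddoP => e e0.
  have /eqaddoP/(_ e e0) fo := diff_locally dff.
  have fg0 : \forall y \near (0 : V), f (y + x) = g (y + x).
    by move: fg; rewrite (near_shift 0 x) /= subr0.
  near=> y.
  have -> : g x = f x by apply/esym/(nbhs_singleton fg).
  have fgy : f (y + x) = g (y + x) by near: y.
  have : `|((f \o shift x - (cst (f x) + 'd f x)) : V -> W) y| <= e * `|y|.
    by near: y.
  by rewrite /= !fctE /= fgy.
have gE : 'd g x = 'd f x :> (V -> W).
  by apply: diff_unique => //; exact: diff_continuous.
apply: DiffDef; last by rewrite gE.
by apply/diff_locallyP; rewrite gE; split=> //; exact: diff_continuous.
Unshelve. all: by end_near. Qed.

Lemma near_differentiable V W (f g : V -> W) (x : V) :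
  (\forall y \near x, f y = g y) -> differentiable f x -> differentiable g x.
Proof. by move=> fg /differentiableP/(is_diff_near fg)[]. Qed.

Lemma near_diff V W (f g : V -> W) (x : V) :
  (\forall y \near x, f y = g y) -> differentiable f x ->
  forall v, 'd g x v = 'd f x v.
Proof. by move=> fg /differentiableP/(is_diff_near fg)[_ ->]. Qed.

Lemma is_diff_scale V W (k dk : V -> R) (f df : V -> W) (x : V) :
  is_diff x k dk -> is_diff x f df ->
  is_diff x (fun y => k y *: f y) (fun v => dk v *: f x + k x *: df v).
Proof.
move=> kx fx.
have bil : bilinear_for *:%R *:%R (@GRing.scale R W).
  split=> [u'|u] a y z /=; first by rewrite scalerDl scalerA.
  by rewrite scalerDr !scalerA mulrC.
pose sM := bilinear_isBilinear.Build R R W W _ _ _ bil.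
pose s : {bilinear R -> W -> W} := HB.pack (@GRing.scale R W) sM.
have sc : continuous (fun p : R * W => s p.1 p.2).
  by move=> p; apply: (@scale_continuous R W).
have is_s p : is_diff p (fun q : R * W => s q.1 q.2)
    (fun q => s p.1 q.2 + s q.1 p.2).
  apply: DiffDef; first exact: differentiable_bilin.
  exact: diff_bilin.
apply: (@is_diff_eq _ _ _ (fun y => k y *: f y)
  ((fun q => s (k x) q.2 + s q.1 (f x)) \o (fun v => (dk v, df v)))).
  apply: (@is_diff_comp _ _ _ _ (fun y => (k y, f y)) _ (fun q : R * W => s q.1 q.2)).
by apply/funext => v /=; rewrite addrC.
Qed.

Lemma is_diff_add V W (f g df dg : V -> W) (x : V) :
  is_diff x f df -> is_diff x g dg ->
  is_diff x (fun y => f y + g y) (fun v => df v + dg v).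
Proof. exact: is_diffD. Qed.

Lemma is_diff_sub V W (f g df dg : V -> W) (x : V) :
  is_diff x f df -> is_diff x g dg ->
  is_diff x (fun y => f y - g y) (fun v => df v - dg v).
Proof. exact: is_diffB. Qed.

Lemma is_diff_mul V (f g df dg : V -> R) (x : V) :
  is_diff x f df -> is_diff x g dg ->
  is_diff x (fun y => f y * g y) (fun v => df v * g x + f x * dg v).
Proof. exact: is_diff_scale. Qed.

Lemma is_diff_const V W (w : W) (x : V) : is_diff x (fun _ => w) (fun _ => 0).
Proof. exact: is_diff_cst. Qed.

Lemma is_diff_sum V W (I : Type) (r : seq I) (P : pred I) (f df : I -> V -> W) (x : V) :
  (forall i, is_diff x (f i) (df i)) ->
  is_diff x (fun y => \sum_(i <- r | P i) f i y) (fun v => \sum_(i <- r | P i) df i v).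
Proof.
move=> h.
have : is_diff x (\sum_(i <- r | P i) f i) (\sum_(i <- r | P i) df i).
  elim/big_rec2: _ => [|i g dg _ IH]; first exact: is_diff_cst.
  exact: is_diffD.
by congr (is_diff x _ _); apply/funext => y; elim/big_rec2: _ => // i f1 f2 _ <-.
Qed.

Lemma is_diff_coord n (x : 'rV[R]_n) i : is_diff x (fun y => y 0 i) (fun v => v 0 i).
Proof.
apply: linear_is_diff; last exact: coord_continuous.
by move=> a u v; rewrite !mxE.
Qed.

(** In finite dimension continuity comes for free: the map is a finite sum of coordinates times
    constant vectors. *)
Lemma rV_linear_is_diff n W (f : 'rV[R]_n -> W) x : linear f -> is_diff x f f.
Proof.
move=> lf; pose fM := GRing.isLinear.Build _ _ _ _ _ lf.
pose F : {linear 'rV[R]_n -> W} := HB.pack f fM.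
have E : f = fun y => \sum_i y 0 i *: f 'e_i.
  apply/funext => y; rewrite -[f]/(F : _ -> _) [in LHS](row_sum_delta y) linear_sum.
  by apply: eq_bigr => i _; rewrite linearZ.
have -> : is_diff x f f = is_diff x (fun y => \sum_i y 0 i *: f 'e_i)
   (fun v => \sum_i (v 0 i *: f 'e_i + x 0 i *: (0 : W))).
  congr (is_diff x _ _); [exact: E|apply/funext => v; rewrite {1}E].
  by apply: eq_bigr => i _; rewrite scaler0 addr0.
by apply: is_diff_sum => i; apply: is_diff_scale; exact: is_diff_coord.
Qed.

End Differentials.

(** * Closure properties of maps of class C^k on open sets *)

Section Smooth.
Context {R : realType}.

Lemma Ck_on_eq n (W : normedModType R) k (U : set 'rV[R]_n) (f g : 'rV[R]_n -> W) :
  open U -> (forall x, U x -> f x = g x) -> Ck_on k U f -> Ck_on k U g.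
Proof.
move=> oU; elim: k f g => [|k IH] f g fg /=.
  move=> cf x Ux; have fgx : \forall y \near x, f y = g y.
    by apply: filterS (open_nbhs_nbhs (conj oU Ux)) => y /fg.
  change (g @ x --> g x); rewrite -(fg x Ux); apply: cvg_trans (cf x Ux).
  exact: near_eq_cvg fgx.
have fgx x : U x -> \forall y \near x, f y = g y.
  by move=> Ux; apply: filterS (open_nbhs_nbhs (conj oU Ux)) => y /fg.
move=> [df ddf]; split=> [x Ux|v]; first exact: near_differentiable (fgx x Ux) (df x Ux).
apply: IH (ddf v) => x Ux; exact/esym/(near_diff (fgx x Ux) (df x Ux)).
Qed.

Lemma Ck_on_sub n (W : normedModType R) k (U U' : set 'rV[R]_n) (f : 'rV[R]_n -> W) :
  U' `<=` U -> Ck_on k U f -> Ck_on k U' f.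
Proof.
move=> sU; elim: k f => [|k IH] f /=; first by move=> h x /sU /h.
by move=> [h1 h2]; split=> [x /sU /h1 //|v]; exact: IH.
Qed.

Lemma Ck_onW n (W : normedModType R) k (U : set 'rV[R]_n) (f : 'rV[R]_n -> W) :
  Ck_on k.+1 U f -> Ck_on k U f.
Proof.
elim: k f => [|k IH] f [h1 h2]; first by move=> x Ux; apply/differentiable_continuous/h1.
by split=> // v; apply: IH.
Qed.

(** Lets an explicit derivative formula stand in for ['d f]; most closure properties below are
    inductions on the order through this step. *)
Lemma Ck_on_step n (W : normedModType R) k (U : set 'rV[R]_n) (f : 'rV[R]_n -> W)
    (df : 'rV[R]_n -> 'rV[R]_n -> W) : open U ->
  (forall x, U x -> is_diff x f (df x)) -> (forall v, Ck_on k U (df^~ v)) ->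
  Ck_on k.+1 U f.
Proof.
move=> oU hd hk; split=> [x /hd[]//|v].
by apply: Ck_on_eq (hk v) => // x Ux; have [_ ->] := hd x Ux.
Qed.

Lemma Ck_on_cst n (W : normedModType R) k (U : set 'rV[R]_n) (w : W) :
  open U -> Ck_on k U (fun _ : 'rV[R]_n => w).
Proof.
move=> oU; elim: k w => [|k IH] w; first by move=> x _; apply: cst_continuous.
apply: (@Ck_on_step _ _ _ _ _ (fun _ _ => 0)) => // x Ux; exact: is_diff_cst.
Qed.

Lemma Ck_on_linear n (W : normedModType R) k (U : set 'rV[R]_n) (f : 'rV[R]_n -> W) :
  open U -> linear f -> Ck_on k U f.
Proof.
move=> oU lf; case: k => [|k].
  move=> x _; apply: differentiable_continuous.
  by have [] := rV_linear_is_diff x lf.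
apply: (@Ck_on_step _ _ _ _ _ (fun _ => f)) => // [x Ux|v].
  exact: rV_linear_is_diff.
exact: Ck_on_cst.
Qed.

Lemma Ck_onD n (W : normedModType R) k (U : set 'rV[R]_n) (f g : 'rV[R]_n -> W) :
  open U -> Ck_on k U f -> Ck_on k U g -> Ck_on k U (fun x => f x + g x).
Proof.
move=> oU; elim: k f g => [|k IH] f g /=.
  by move=> cf cg x Ux; apply: (@continuousD R W _ f g); [apply: cf|apply: cg].
move=> [df ddf] [dg ddg].
apply: (@Ck_on_step _ _ _ _ _ (fun x v => 'd f x v + 'd g x v)) => // [x Ux|v].
  by apply: is_diffD; apply: differentiableP; [apply: df|apply: dg].
exact: IH.
Qed.

Lemma Ck_on_sum n (W : normedModType R) k (U : set 'rV[R]_n) (I : Type) (r : seq I)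
    (f : I -> 'rV[R]_n -> W) :
  open U -> (forall i, Ck_on k U (f i)) -> Ck_on k U (fun x => \sum_(i <- r) f i x).
Proof.
move=> oU h; elim: r => [|i r IH].
  by apply: Ck_on_eq (Ck_on_cst k 0 oU) => // x _; rewrite big_nil.
by apply: Ck_on_eq (Ck_onD oU (h i) IH) => // x _; rewrite big_cons.
Qed.

Lemma Ck_onZ n (W : normedModType R) k (U : set 'rV[R]_n) (a : 'rV[R]_n -> R)
    (f : 'rV[R]_n -> W) :
  open U -> Ck_on k U a -> Ck_on k U f -> Ck_on k U (fun x => a x *: f x).
Proof.
move=> oU; elim: k a f => [|k IH] a f.
  by move=> ca cf x Ux; apply: continuousZ; [apply: ca|apply: cf].
move=> ha hf; have [da dda] := ha; have [df ddf] := hf.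
apply: (@Ck_on_step _ _ _ _ _ (fun x v => 'd a x v *: f x + a x *: 'd f x v)) => // [x Ux|v].
  apply: is_diff_scale; first exact/differentiableP/da.
  exact/differentiableP/df.
apply: Ck_onD => //; first exact: (IH _ _ (dda v) (Ck_onW hf)).
exact: (IH _ _ (Ck_onW ha) (ddf v)).
Qed.

(** The chain rule evaluates ['d g (f x)] at a vector that moves with [x], while [Ck_on] speaks of
    fixed directions. Expanding that vector in the standard basis leaves products of C^k functions.
    The codomain is generalised in the induction, which is also applied to scalar components. *)
Lemma Ck_on_comp n m (W : normedModType R) k (U : set 'rV[R]_n) (U' : set 'rV[R]_m)
    (f : 'rV[R]_n -> 'rV[R]_m) (g : 'rV[R]_m -> W) :
  open U -> (forall x, U x -> U' (f x)) -> Ck_on k U f -> Ck_on k U' g ->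
  Ck_on k U (g \o f).
Proof.
move=> oU; elim: k W U' f g => [|k IH] W U' f g fU.
  by move=> cf cg x Ux; apply: continuous_comp; [exact: cf|exact/cg/fU].
move=> hf hg; have [df ddf] := hf; have [dg ddg] := hg.
apply: (@Ck_on_step _ _ _ _ _ (fun x v => \sum_i ('d f x v) 0 i *: 'd g (f x) 'e_i))
  => // [x Ux|v].
  have /differentiableP hfx := df x Ux; have /differentiableP hgx := dg _ (fU x Ux).
  apply: is_diff_eq; apply/funext => v /=.
  rewrite [in LHS](row_sum_delta ('d f x v)) linear_sum.
  by apply: eq_bigr => i _; rewrite linearZ.
apply: Ck_on_sum => // i; apply: Ck_onZ => //.
  apply: (IH _ setT (fun x => 'd f x v) (fun y => y 0 i) _ (ddf v)) => //.
  by apply: Ck_on_linear => [|a u w]; [exact: openT|rewrite !mxE].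
exact: (IH _ _ _ _ fU (Ck_onW hf) (ddg _)).
Qed.

End Smooth.

(** * Symmetry of second derivatives *)

Section Schwarz.
Context {R : realType} {V : normedModType R}.

Lemma is_derive_line (W : normedModType R) (f : V -> W) (p v : V) (s : R) :
  differentiable f (p + s *: v) ->
  is_derive s 1 (fun t : R => f (p + t *: v)) ('d f (p + s *: v) v).
Proof.
move=> df.
have dl : is_diff s (fun t : R => p + t *: v) (fun t => t *: v).
  apply: is_diff_eq (is_diff_add (is_diff_const p s) (is_diff_scalel s v)) _.
  by apply/funext => t; rewrite add0r.
have [dc dE] := @is_diff_comp _ _ _ _ _ _ f _ s dl (differentiableP df).
apply: DeriveDef; first exact: diff_derivable.
by rewrite deriveE // -[LHS]/('d (f \o (fun t => p + t *: v)) s 1) dE /= scale1r.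
Qed.

(* The mean value theorem along [v] and the first-order expansion of [y |-> 'd f y v]
   at [x]; the left-hand second difference is symmetric in [v] and [w]. *)
Lemma second_difference (f : V -> R) (x v w : V) (e : R) : 0 < e ->
  (\forall y \near x, differentiable f y) ->
  differentiable (fun y => 'd f y v) x ->
  exists2 d : R, 0 < d & forall h, 0 < h < d ->
    `|f (x + h *: w + h *: v) - f (x + h *: w) - (f (x + h *: v) - f x)
      - h * h * 'd (fun y => 'd f y v) x w| <= e * (h * h).
Proof.
move=> e0 df dG; set G := fun y => _ in dG *.
(* The norms of the two displacements below add up to at most [h * N], so the tolerance [e / N]
   gives a total error [e * h]. The [1] keeps [N] positive when [v] and [w] vanish. *)
pose N := `|v| + `|v| + `|w| + 1.
have N0 : 0 < N by rewrite /N ltr_wpDl // !addr_ge0.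
have eN : 0 < e / N by rewrite divr_gt0.
have /eqaddoP/(_ _ eN) Go := diff_locally dG.
move: df; rewrite (near_shift 0 x) /= subr0 => df.
have [d /= d0 hd] := (nbhs_ballP _ _).1 (filterI Go df).
have hd' y : `|y| < d -> `|G (y + x) - G x - 'd G x y| <= e / N * `|y| /\
    differentiable f (y + x).
  move=> yd; have [] := hd y; first by rewrite -ball_normE /= sub0r normrN.
  by rewrite /= !fctE /= opprD addrA => ? ?; split.
exists (d / N) => [|h /andP[h0 hdN]]; first by rewrite divr_gt0.
have hN : h * N < d by rewrite -ltr_pdivlMr.
have small s : 0 <= s <= h -> `|s *: v + h *: w| <= h * N /\ `|s *: v| <= h * N /\
   `|s *: v + h *: w| + `|s *: v| <= h * N.
  move=> /andP[s0 sh].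
  have h1 : `|s *: v + h *: w| <= s * `|v| + h * `|w|.
    by rewrite (le_trans (ler_normD _ _)) // !normrZ !ger0_norm // ltW.
  have h2 : `|s *: v| = s * `|v| by rewrite normrZ ger0_norm.
  have h3 : s * `|v| <= h * `|v| by rewrite ler_wpM2r.
  have h4 : 0 <= h * `|w| by rewrite mulr_ge0 // ltW.
  have h5 : 0 <= h * `|v| by rewrite mulr_ge0 // ltW.
  have h6 : h * N = h * `|v| + h * `|v| + h * `|w| + h by rewrite /N; ring.
  by rewrite h2 h6; split; [|split]; lra.
(* Its derivative in [s] is a difference of values of [G] at two points near [x], whose expansions
   at [x] differ by [h] times the derivative of [G] along [w]. *)
pose phi (s : R) := f (x + h *: w + s *: v) - f (x + s *: v).
have dphi s : 0 <= s <= h ->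
    is_derive s 1 phi (G (x + h *: w + s *: v) - G (x + s *: v)).
  move=> hs; have [b1 [b2 _]] := small s hs.
  apply: is_deriveB; apply: is_derive_line.
    have [_] := hd' _ (le_lt_trans b1 hN).
    by rewrite [s *: v + h *: w]addrC [_ + x]addrC addrA.
  have [_] := hd' _ (le_lt_trans b2 hN).
  by rewrite addrC.
have [c /itvP ch E] : exists2 c : R, c \in `]0, h[ &
    phi h - phi 0 = (G (x + h *: w + c *: v) - G (x + c *: v)) * (h - 0).
  apply: (@MVT R phi (fun s => G (x + h *: w + s *: v) - G (x + s *: v))) => //.
    by move=> s /itvP hs; apply: dphi; rewrite !hs.
  apply: continuous_in_subspaceT => s /set_mem /itvP hs.
  apply: differentiable_continuous; apply/derivable1_diffP.
  by have := dphi s; rewrite !hs => -[].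
have [b1 [b2 b3]] : `|c *: v + h *: w| <= h * N /\ `|c *: v| <= h * N /\
   `|c *: v + h *: w| + `|c *: v| <= h * N by apply: small; rewrite !ltW // ch.
have [c1 _] := hd' _ (le_lt_trans b1 hN).
have [c2 _] := hd' _ (le_lt_trans b2 hN).
have -> : f (x + h *: w + h *: v) - f (x + h *: w) - (f (x + h *: v) - f x) = phi h - phi 0.
  by rewrite /phi scale0r !addr0; ring.
have e1 : x + h *: w + c *: v = c *: v + h *: w + x.
  by rewrite addrC [x + _]addrC addrA.
rewrite E subr0 e1 (addrC x (c *: v)).
have dl : 'd G x (c *: v + h *: w) = c * 'd G x v + h * 'd G x w.
  by rewrite linearD !linearZ.
have dl' : 'd G x (c *: v) = c * 'd G x v by rewrite linearZ.
move: c1 c2; rewrite dl dl'.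
set A := G _; set B := G (_ + x); set Dw := 'd G x w; set Dv := 'd G x v; set g := G x.
move=> c1 c2.
have -> : (A - B) * h - h * h * Dw =
   h * ((A - g - (c * Dv + h * Dw)) - (B - g - c * Dv)) by ring.
rewrite normrM gtr0_norm // [e * _]mulrCA ler_pM2l //.
rewrite (le_trans (ler_normB _ _)) // (le_trans (lerD c1 c2)) //.
rewrite -mulrDr (le_trans (ler_wpM2l (ltW eN) b3)) //.
by rewrite mulrCA -mulrA mulVf ?mulr1 ?gt_eqF // mulrC.
Qed.

(** One second difference approximates [h * h] times either mixed derivative, with error
    [e / 2 * (h * h)] each; dividing by [h * h] bounds their distance by every positive [e]. *)
Lemma diff_diffC (f : V -> R) (x v w : V) :
  (\forall y \near x, differentiable f y) ->
  differentiable (fun y => 'd f y v) x -> differentiable (fun y => 'd f y w) x ->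
  'd (fun y => 'd f y v) x w = 'd (fun y => 'd f y w) x v.
Proof.
move=> df dv dw; apply/eqP; rewrite -subr_eq0 -normr_le0.
apply/ler_addgt0Pr => e e0; rewrite add0r.
have e2 : 0 < e / 2 by rewrite divr_gt0.
have [d1 d10 h1] := second_difference w e2 df dv.
have [d2 d20 h2] := second_difference v e2 df dw.
pose h := Num.min d1 d2 / 2.
have h0 : 0 < h by rewrite divr_gt0 // lt_min d10.
have hm : h < Num.min d1 d2 by rewrite /h ltr_pdivrMr // ltr_pMr ?ltr1n // lt_min d10.
move: hm; rewrite lt_min => /andP[hd1 hd2].
have {h1} := h1 h; rewrite h0 hd1 => /(_ isT).
have {h2} := h2 h; rewrite h0 hd2 => /(_ isT).
rewrite (_ : x + h *: w + h *: v = x + h *: v + h *: w); last by rewrite addrAC.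
set A := f _; set B := f _; set C := f _; set D := f _; set p := 'd _ _ _; set q := 'd _ _ _.
move=> k1 k2.
have hh : 0 < h * h by rewrite mulr_gt0.
rewrite -(ler_pM2l hh) -[h * h in leLHS]ger0_norm ?(ltW hh) // -normrM.
have -> : h * h * (q - p) = (A - B - (C - D) - h * h * p) - (A - C - (B - D) - h * h * q).
  by ring.
rewrite (le_trans (ler_normB _ _)) //.
have -> : h * h * e = e / 2 * (h * h) + e / 2 * (h * h) by field.
exact: lerD.
Qed.

End Schwarz.

(** * Charts and coordinate fields *)

Section Charts.
Context {R : realType} {n : nat} {T : topologicalType} (c : chart R n T).
Hypothesis hc : is_chart c.

Lemma cmapK p : cdom c p -> cinv c (cmap c p) = p.
Proof. by case: hc => _ _ h _ _; exact: h. Qed.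

Lemma cimg_cmap (U : set T) p : U p -> cdom c p -> cimg c U (cmap c p).
Proof. by move=> Up cp; exists p. Qed.

Lemma cimgS (U V : set T) : U `<=` V -> cimg c U `<=` cimg c V.
Proof. by move=> UV y [p [/UV Vp cp] <-]; exists p. Qed.

Lemma cimg_cinv (U : set T) y : cimg c U y ->
  [/\ U (cinv c y), cdom c (cinv c y) & cmap c (cinv c y) = y].
Proof. by move=> [p [Up cp] <-]; rewrite cmapK. Qed.

Lemma cinv_continuous y : cimg c setT y -> {for y, continuous (cinv c)}.
Proof.
case: hc => _ oi _ _ ci iy.
by move: ci; rewrite continuous_open_subspace // => /(_ y); apply; rewrite inE.
Qed.

Lemma cimg_open (U : set T) : open U -> open (cimg c U).
Proof.
move=> oU; rewrite openE => y cUy; have [Uy cy cE] := cimg_cinv cUy.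
have iy : cimg c setT y by apply: cimgS cUy.
have : nbhs y (cinv c @^-1` U).
  by apply: (cinv_continuous iy); exact: open_nbhs_nbhs.
have : nbhs y (cimg c setT).
  by apply: open_nbhs_nbhs; split=> //; case: hc.
move=> h1 h2; apply: filterS (filterI h1 h2) => z [iz Uz].
by have [_ cz <-] := cimg_cinv iz; exists (cinv c z).
Qed.

Lemma near_cinv p (P : set T) : cdom c p ->
  (\forall q \near p, P q) -> \forall y \near cmap c p, P (cinv c y).
Proof.
move=> cp hP; apply: (@cinv_continuous (cmap c p)); first exact: cimg_cmap.
by rewrite /= cmapK.
Qed.

Lemma near_cimg p (U : set T) : cdom c p -> open U -> U p ->
  \forall y \near cmap c p, cimg c U y.
Proof.
by move=> cp oU Up; apply: open_nbhs_nbhs; split; [exact: cimg_open|exact: cimg_cmap].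
Qed.

Lemma open_cdom : open (cdom c).
Proof. by case: hc. Qed.

End Charts.

(** * Changes of chart, tangent vectors and coordinate fields *)

Section Transitions.
Context {R : realType} {n : nat} {M : manifold R n}.
Implicit Types (c d : chart R n M) (p : M).

Lemma transition_diff c d p : atlas c -> atlas d -> cdom c p -> cdom d p ->
  differentiable (cmap d \o cinv c) (cmap c p).
Proof.
by move=> ac ad cp dp; have [h _] := atlas_smooth ac ad 1; apply: h; exact: cimg_cmap.
Qed.

Lemma near_transition (W : Type) (f : M -> W) c d p : atlas c -> atlas d ->
  cdom c p -> cdom d p ->
  \forall y \near cmap c p, ((f \o cinv d) \o (cmap d \o cinv c)) y = (f \o cinv c) y.
Proof.
move=> ac ad cp dp; have hc := atlas_chart ac; have hd := atlas_chart ad.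
have : \forall q \near p, cdom d q.
  by apply: open_nbhs_nbhs; split=> //; exact: open_cdom hd.
move=> /(near_cinv hc cp); apply: filterS => y dy /=.
by rewrite (cmapK hd dy).
Qed.

Lemma is_diff_transition (W : normedModType R) (f : M -> W) c d p :
  atlas c -> atlas d -> cdom c p -> cdom d p ->
  differentiable (f \o cinv d) (cmap d p) ->
  is_diff (cmap c p) (f \o cinv c)
    ('d (f \o cinv d) (cmap d p) \o 'd (cmap d \o cinv c) (cmap c p)).
Proof.
move=> ac ad cp dp df; apply: is_diff_near (near_transition f ac ad cp dp) _.
have h1 := differentiableP (transition_diff ac ad cp dp).
have h2 := differentiableP df.
by apply: is_diff_compose h1 h2; rewrite /= (cmapK (atlas_chart ac) cp).
Qed.

(** The composite of the two transition maps is the identity near the point, and the chain rule does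
    the rest. *)
Lemma transitionK c d p v : atlas c -> atlas d -> cdom c p -> cdom d p ->
  'd (cmap c \o cinv d) (cmap d p) ('d (cmap d \o cinv c) (cmap c p) v) = v.
Proof.
move=> ac ad cp dp.
have cc : \forall y \near cmap c p, id y = (cmap c \o cinv c) y.
  have := near_cimg (atlas_chart ac) cp openT I; apply: filterS => y iy /=.
  by have [_ _ ->] := cimg_cinv (atlas_chart ac) iy.
have h := is_diff_transition ac ad cp dp (transition_diff ad ac dp cp).
transitivity ('d (cmap c \o cinv c) (cmap c p) v); first exact/esym/(is_diffE h).
exact: is_diffE (is_diff_near cc (is_diff_id _)) v.
Qed.

Lemma tcoordD c p (v w : tangent p) : tcoord c (v + w) = tcoord c v + tcoord c w.
Proof. exact: linearD. Qed.

Lemma tcoordZ c p a (v : tangent p) : tcoord c (a *: v) = a *: tcoord c v.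
Proof. exact: linearZ. Qed.

Lemma tcoordN c p (v : tangent p) : tcoord c (- v) = - tcoord c v.
Proof. exact: linearN. Qed.

Lemma tcoord0 c p : tcoord c (0 : tangent p) = 0.
Proof. exact: linear0. Qed.

(* The coordinate field of [c] in the direction [a], extended by [0]. *)
Definition cfield c (a : 'rV[R]_n) : vfield M := fun p =>
  if asbool (cdom c p) then 'd (cmap (mchart p) \o cinv c) (cmap c p) a else 0.

(** Tangent vectors and [mdiff] refer to a preferred chart that varies with the point; this moves
    the computation to one fixed chart. *)
Lemma mdiffE (W : normedModType R) (f : M -> W) c p (v : tangent p) :
  atlas c -> cdom c p -> differentiable (f \o cinv c) (cmap c p) ->
  mdiff f v = 'd (f \o cinv c) (cmap c p) (tcoord c v).
Proof.
move=> ac cp df; rewrite /tcoord /mdiff.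
exact: is_diffE (is_diff_transition (mchart_atlas p) ac (mchart_dom p) cp df) v.
Qed.

(** Every tangent vector is a value of a coordinate field, so curvature tensors need only be
    evaluated on such fields, whose brackets vanish. *)
Lemma cfieldK c p (v : tangent p) : atlas c -> cdom c p -> cfield c (tcoord c v) p = v.
Proof.
move=> ac cp; rewrite /cfield asboolT // /tcoord /mdiff.
exact: (transitionK _ (mchart_atlas p) ac (mchart_dom p) cp).
Qed.

Lemma mdiff_cfield (W : normedModType R) (f : M -> W) c a p :
  atlas c -> cdom c p -> differentiable (f \o cinv c) (cmap c p) ->
  mdiff f (cfield c a p) = 'd (f \o cinv c) (cmap c p) a.
Proof.
move=> ac cp df; rewrite (mdiffE _ ac cp df); congr ('d _ _ _).
rewrite /cfield asboolT // /tcoord /mdiff.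
exact: (transitionK _ ac (mchart_atlas p) cp (mchart_dom p)).
Qed.

Lemma tcoord_cfield c a p : atlas c -> cdom c p -> tcoord c (cfield c a p) = a.
Proof.
move=> ac cp; rewrite /cfield asboolT // /tcoord /mdiff.
exact: (transitionK _ ac (mchart_atlas p) cp (mchart_dom p)).
Qed.

Lemma tcoord_inj c p (v w : tangent p) :
  atlas c -> cdom c p -> tcoord c v = tcoord c w -> v = w.
Proof. by move=> ac cp E; rewrite -(cfieldK v ac cp) E cfieldK. Qed.

Lemma cfieldD c a b p : cfield c (a + b) p = cfield c a p + cfield c b p.
Proof. by rewrite /cfield; case: asbool; rewrite ?addr0 // linearD. Qed.

Lemma cfieldZ c k a p : cfield c (k *: a) p = k *: cfield c a p.
Proof. by rewrite /cfield; case: asbool; rewrite ?scaler0 // linearZ. Qed.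

Lemma vf_coord_cfield c d a y : atlas c -> atlas d -> cimg d (cdom c) y ->
  vf_coord (cfield c a) d y =
  'd (cmap d \o cinv c) ((cmap c \o cinv d) y) a.
Proof.
move=> ac ad; have hd := atlas_chart ad => iy.
have [cy dy yE] := cimg_cinv hd iy.
by rewrite /vf_coord /tcoord mdiff_cfield //; exact: transition_diff.
Qed.

Lemma cfield_smooth c a : atlas c -> vf_smooth (cdom c) (cfield c a).
Proof.
move=> ac d ad k; have hd := atlas_chart ad; have hc := atlas_chart ac.
have od : open (cimg d (cdom c)) by apply: cimg_open hd _ (open_cdom hc).
apply: (@Ck_on_eq _ _ _ _ _
  ((fun y => 'd (cmap d \o cinv c) y a) \o (cmap c \o cinv d))) => //.
  by move=> y iy; rewrite vf_coord_cfield.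
apply: (@Ck_on_comp _ _ _ _ _ _ (cimg c (cdom d))) => //.
- move=> y iy; have [cy dy yE] := cimg_cinv hd iy.
  exact: cimg_cmap.
- exact: atlas_smooth.
- exact: (proj2 (atlas_smooth ac ad k.+1) a).
Qed.

Lemma is_diff_component m (V : normedModType R) (f : V -> 'rV[R]_m) i x :
  differentiable f x -> is_diff x (fun y => f y 0 i) (fun v => 'd f x v 0 i).
Proof.
move=> /differentiableP df.
exact: (@is_diff_comp _ _ _ _ f _ (fun y => y 0 i) _ x df (is_diff_coord _ _)).
Qed.

Lemma smooth_diff_diffC m k (U : set 'rV[R]_m) (f : 'rV[R]_m -> 'rV[R]_k) x v w :
  open U -> U x -> Ck_on 2 U f ->
  'd (fun y => 'd f y v) x w = 'd (fun y => 'd f y w) x v.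
Proof.
move=> oU Ux [df ddf]; have nU := open_nbhs_nbhs (conj oU Ux).
apply/rowP => i.
have ndf : \forall y \near x, differentiable f y by apply: filterS nU => y /df.
have E u : \forall y \near x, 'd f y u 0 i = 'd (fun z => f z 0 i) y u.
  near=> y; have dfy : differentiable f y by near: y.
  exact/esym/(is_diffE (is_diff_component i dfy)).
have D u u' : 'd (fun y => 'd f y u) x u' 0 i = 'd (fun y => 'd (fun z => f z 0 i) y u) x u'.
  have [d1 _] := ddf u; have h1 := is_diff_component i (d1 x Ux).
  exact/esym/(is_diffE (is_diff_near (E u) h1)).
have D' u : differentiable (fun y => 'd (fun z => f z 0 i) y u) x.
  have [d1 _] := ddf u; have h1 := is_diff_component i (d1 x Ux).
  by have [] := is_diff_near (E u) h1.
rewrite !D; apply: diff_diffC => //; apply: filterS ndf => y dfy.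
by have [] := is_diff_component i dfy.
Unshelve. all: by end_near. Qed.

(** [lie] is evaluated in the preferred chart, where a coordinate field of [c] is given by the
    Jacobian of the transition. Each half of the bracket is then a second derivative of that
    transition, and the two agree by symmetry. *)
Lemma lie_cfield c a b p : atlas c -> cdom c p -> lie (cfield c a) (cfield c b) p = 0.
Proof.
move=> ac cp; set d := mchart p; have ad : atlas d := mchart_atlas p.
have dp : cdom d p := mchart_dom p.
have hd := atlas_chart ad; have hc := atlas_chart ac.
have od := cimg_open hd (open_cdom hc).
have oc := cimg_open hc (open_cdom hd).
have key u v : 'd (vf_coord (cfield c u) d) (cmap d p) (vf_coord (cfield c v) d (cmap d p))
    = 'd (fun y => 'd (cmap d \o cinv c) y u) (cmap c p) v.
  have near_eq : \forall y \near cmap d p,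
      ((fun y => 'd (cmap d \o cinv c) y u) \o (cmap c \o cinv d)) y
      = vf_coord (cfield c u) d y.
    apply: filterS (near_cimg hd dp (open_cdom hc) cp) => y iy.
    by rewrite vf_coord_cfield.
  have [_ h] := atlas_smooth ac ad 2; have [h1 _] := h u.
  have h2 := differentiableP (h1 (cmap c p) (cimg_cmap dp cp)).
  have h3 := differentiableP (transition_diff ad ac dp cp).
  have h4 : is_diff (cmap d p)
     ((fun y => 'd (cmap d \o cinv c) y u) \o (cmap c \o cinv d))
     ('d (fun y => 'd (cmap d \o cinv c) y u) (cmap c p) \o 'd (cmap c \o cinv d) (cmap d p)).
    by apply: is_diff_compose h3 h2; rewrite /= (cmapK hd dp).
  have e1 : vf_coord (cfield c v) d (cmap d p) = 'd (cmap d \o cinv c) (cmap c p) v.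
    apply: etrans (vf_coord_cfield v ac ad (cimg_cmap cp dp)) _.
    by rewrite -[(_ \o _) (cmap d p)]/(cmap c (cinv d (cmap d p))) (cmapK hd dp).
  have h5 := @is_diff_near _ _ _ _ (vf_coord (cfield c u) d) _ _ near_eq h4.
  apply: etrans (is_diffE h5 _) _.
  rewrite e1 -[LHS]/('d (fun y => 'd (cmap d \o cinv c) y u) (cmap c p)
    ('d (cmap c \o cinv d) (cmap d p) ('d (cmap d \o cinv c) (cmap c p) v))).
  by congr ('d _ _ _); exact: transitionK.
rewrite /lie -/d.
have := smooth_diff_diffC b a oc (cimg_cmap dp cp) (atlas_smooth ac ad 2).
move=> E; apply/eqP; rewrite subr_eq0; apply/eqP.
exact: etrans (key b a) (etrans E (esym (key a b))).
Qed.

End Transitions.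

(** * Koszul's formula in coordinates *)

Definition koszul_of {R : realType} (m : nat)
    (g : 'rV[R]_m -> 'rV[R]_m -> 'rV[R]_m -> R) (c a b y : 'rV[R]_m) : R :=
  2^-1 * ('d (g a b) y c + 'd (g c b) y a - 'd (g c a) y b).

Section Koszul.
Context {R : realType} {n : nat} {N : manifold R n}.
Variables (g : forall x : N, tangent x -> tangent x -> R)
  (D : connection (tangent_family N))
  (Rm : forall p : N, tangent p -> tangent p -> tangent p -> tangent p).
Hypotheses (hD : is_levi_civita g D)
  (hR : @is_curvature _ _ _ (tangent_family N) D Rm).
Variables (c : chart R n N) (U : set N).
Hypotheses (ac : atlas c) (oU : open U) (Uc : U `<=` cdom c).
Hypothesis g_sym : forall q (u v : tangent q), U q -> g u v = g v u.
Hypothesis g_lin : forall q a (u v w : tangent q), U q ->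
  g (a *: u + v) w = a * g u w + g v w.

Definition metric_coord (a b : 'rV[R]_n) (y : 'rV[R]_n) : R :=
  g (cfield c a (cinv c y)) (cfield c b (cinv c y)).

Lemma metric_coordE p (u v : tangent p) : cdom c p ->
  metric_coord (tcoord c u) (tcoord c v) (cmap c p) = g u v.
Proof.
move=> cp; rewrite /metric_coord (cmapK (atlas_chart ac) cp).
by rewrite (cfieldK u ac cp) (cfieldK v ac cp).
Qed.

Hypothesis g_diff : forall q a b, U q -> differentiable (metric_coord a b) (cmap c q).

Local Notation koszul := (koszul_of metric_coord).

Lemma cfield_smooth_near q a : U q ->
  @smooth_near _ _ _ (tangent_family N) q (cfield c a).
Proof.
move=> Uq; exists (cdom c); last exact: cfield_smooth.
split; last exact: Uc.
exact: open_cdom (atlas_chart ac).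
Qed.

Lemma metric_coord_diff q a b e : U q ->
  'd (metric_coord b e) (cmap c q) a =
  g (D (cfield c a q) (cfield c b)) (cfield c e q)
  + g (cfield c b q) (D (cfield c a q) (cfield c e)).
Proof.
move=> Uq; have [hc hm ht] := hD.
rewrite -(hm q (cfield c a q) (cfield c b) (cfield c e)); try exact: cfield_smooth_near.
by apply/esym/(mdiff_cfield a ac (Uc Uq)); exact: g_diff.
Qed.

Lemma conn_cfieldC q a b : U q ->
  D (cfield c a q) (cfield c b) = D (cfield c b q) (cfield c a).
Proof.
move=> Uq; have [hc hm ht] := hD; apply/eqP; rewrite -subr_eq0; apply/eqP.
have -> := ht q (cfield c a) (cfield c b) (cfield_smooth_near a Uq)
  (cfield_smooth_near b Uq).
exact: lie_cfield ac (Uc Uq).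
Qed.

(** Metric compatibility expands the three derivatives into six pairings. Coordinate fields commute,
    so [D] is symmetric on them: four pairings cancel and the other two are equal. *)
Lemma koszulE q a b e : U q ->
  koszul a b e (cmap c q) = g (D (cfield c a q) (cfield c b)) (cfield c e q).
Proof.
move=> Uq; rewrite /koszul_of !metric_coord_diff //.
rewrite (conn_cfieldC b a Uq) (conn_cfieldC e a Uq) (conn_cfieldC e b Uq).
rewrite (g_sym (cfield c b q) _ Uq) (g_sym (cfield c a q) _ Uq).
by field.
Qed.

(** Metric compatibility turns the pairing of [D_a D_b e] with [f] into a derivative of a Koszul
    function minus a pairing of two first derivatives. Symmetry and linearity of [g] are assumed on
    [U] only, since those of the total metric are established inside a chart. *)
Lemma curvature_koszul p a b e f : U p ->
  (forall a b e, differentiable (koszul a b e) (cmap c p)) ->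
  g (Rm (cfield c a p) (cfield c b p) (cfield c e p)) (cfield c f p) =
  'd (koszul b e f) (cmap c p) a - 'd (koszul a e f) (cmap c p) b
  - g (D (cfield c b p) (cfield c e)) (D (cfield c a p) (cfield c f))
  + g (D (cfield c a p) (cfield c e)) (D (cfield c b p) (cfield c f)).
Proof.
move=> Up dK; have [hc hm ht] := hD.
have sm a' b' : @smooth_near _ _ _ (tangent_family N) p
    (fun q => D (cfield c a' q) (cfield c b')).
  exists U => //.
  apply: (conn_smooth hc) => //; move=> d ad k.
    by apply: Ck_on_sub (cfield_smooth a' ac ad k); apply: cimgS.
  by apply: Ck_on_sub (cfield_smooth b' ac ad k); apply: cimgS.
have key a' b' : g (D (cfield c a' p) (fun q => D (cfield c b' q) (cfield c e)))
    (cfield c f p) =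
  'd (koszul b' e f) (cmap c p) a' -
   g (D (cfield c b' p) (cfield c e)) (D (cfield c a' p) (cfield c f)).
  apply/eqP; rewrite eq_sym subr_eq; apply/eqP.
  have := hm p (cfield c a' p) (fun q => D (cfield c b' q) (cfield c e)) (cfield c f)
    (sm _ _) (cfield_smooth_near f Up).
  move=> <-.
  have hn : \forall y \near cmap c p, koszul b' e f y =
     ((fun x => g (D (cfield c b' x) (cfield c e)) (cfield c f x)) \o cinv c) y.
    have := near_cimg (atlas_chart ac) (Uc Up) oU Up.
    apply: filterS => y iy; have [Uy _ yE] := cimg_cinv (atlas_chart ac) iy.
    by rewrite -{1}yE koszulE.
  have h := is_diff_near hn (differentiableP (dK b' e f)).
  apply/esym; apply: etrans (mdiff_cfield a' ac (Uc Up) (@ex_diff _ _ _ _ _ _ _ h)) _.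
  exact: (is_diffE h a').
have gB (u v w : tangent p) : g (u - v) w = g u w - g v w.
  by rewrite -scaleN1r addrC g_lin // mulN1r addrC.
have -> : Rm (cfield c a p) (cfield c b p) (cfield c e p) =
    (D (cfield c a p) (fun q => D (cfield c b q) (cfield c e)) : tangent p)
    - D (cfield c b p) (fun q => D (cfield c a q) (cfield c e)).
  have := hR (cfield_smooth_near a Up) (cfield_smooth_near b Up) (cfield_smooth_near e Up).
  rewrite lie_cfield //; last exact: Uc.
  have D0 : D (0 : tangent p) (cfield c e) = 0.
    have := conn_linear hc (-1) (0 : tangent p) (0 : tangent p) (cfield_smooth_near e Up).
    by rewrite scaler0 add0r scaleN1r addNr.
  by rewrite D0 subr0.
rewrite gB !key; ring.
Qed.

End Koszul.

(** * The metric of the total space in coordinates *)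

Lemma is_diff_uniq {R : realType} (V W : normedModType R) (f df df' : V -> W) x v :
  is_diff x f df -> is_diff x f df' -> df v = df' v.
Proof. by move=> h h'; rewrite -(is_diffE h) (is_diffE h'). Qed.

(** Linearity in [q] allows an expansion over the standard basis, so differentiability in [x] for
    each fixed [q] already gives the derivative of the joint expression. Linearity of [dL] in [q]
    follows from uniqueness of derivatives. *)
Lemma is_diff_family {R : realType} (V Z W : normedModType R) k
    (L : Z -> 'rV[R]_k -> W) (dL : 'rV[R]_k -> Z -> W) (x dx : V -> Z)
    (q dq : V -> 'rV[R]_k) (y : V) :
  (forall z, linear (L z)) -> (forall q, is_diff (x y) (L^~ q) (dL q)) ->
  is_diff y x dx -> is_diff y q dq ->
  is_diff y (fun z => L (x z) (q z)) (fun e => dL (q y) (dx e) + L (x y) (dq e)).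
Proof.
move=> lL hL hx hq.
have E z p : L z p = \sum_i p 0 i *: L z 'e_i.
  pose fM := GRing.isLinear.Build _ _ _ _ _ (lL z).
  pose F : {linear 'rV[R]_k -> W} := HB.pack (L z) fM.
  rewrite -[L z]/(F : _ -> _) [in LHS](row_sum_delta p) linear_sum.
  by apply: eq_bigr => i _; rewrite linearZ.
have EL : (fun z => L (x z) (q z)) = fun z => \sum_i q z 0 i *: L (x z) 'e_i.
  by apply/funext => z; rewrite E.
have hi i : is_diff y (fun z => q z 0 i *: L (x z) 'e_i)
    (fun e => dq e 0 i *: L (x y) 'e_i + q y 0 i *: dL 'e_i (dx e)).
  apply: (is_diff_scale (k := fun z => q z 0 i) (f := fun z => L (x z) 'e_i)).
    exact: (is_diff_compose (f := q) (g := fun v => v 0 i) erefl hq (is_diff_coord _ _)).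
  exact: (is_diff_compose (f := x) (g := L^~ 'e_i) erefl hx (hL _)).
have dLE p w : dL p w = \sum_i p 0 i *: dL 'e_i w.
  have h1 : is_diff (x y) (L^~ p) (fun w => \sum_i p 0 i *: dL 'e_i w).
    rewrite (_ : L^~ p = fun z => \sum_i p 0 i *: L z 'e_i); last first.
      by apply/funext => z; rewrite E.
    by apply: is_diff_sum => i; apply: is_diffZ.
  exact: is_diff_uniq (hL p) h1.
rewrite EL; apply: is_diff_eq (is_diff_sum _ _ hi) _.
apply/funext => e; rewrite big_split /= addrC; congr (_ + _); last by rewrite E.
by rewrite [RHS]dLE.
Qed.

(** Where [q] vanishes, the derivative of [L] in its parameter drops out and only has to exist. This
    is the form used at the zero section. *)
Lemma is_diff_family0 {R : realType} (V Z W : normedModType R) k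
    (L : Z -> 'rV[R]_k -> W) (x dx : V -> Z) (q dq : V -> 'rV[R]_k) (y : V) :
  (forall z, linear (L z)) -> (forall q, differentiable (L^~ q) (x y)) ->
  is_diff y x dx -> is_diff y q dq -> q y = 0 ->
  is_diff y (fun z => L (x z) (q z)) (fun e => L (x y) (dq e)).
Proof.
move=> lL hL hx hq q0.
apply: is_diff_eq (is_diff_family lL (fun q => differentiableP (hL q)) hx hq) _.
have L0 z : L z 0 = 0.
  by apply: (addrI (L z 0)); rewrite addr0 -{2}[L z 0]scale1r addrC -lL scale1r addr0.
apply/funext => e; rewrite q0 [X in X + _](_ : _ = 0) ?add0r //.
have : is_diff (x y) (L^~ 0) (fun _ => 0).
  by rewrite (_ : L^~ 0 = cst 0); [exact: is_diff_cst|apply/funext => z; rewrite L0].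
by move=> h; rewrite (is_diffE h).
Qed.

(* [f'] is the derivative of [f] on [r >= 0], in the form of a chain rule; the values of
   [f] at negative arguments do not matter. *)
Definition halfline_diff {R : realType} (f f' : R -> R) : Prop :=
  forall (V : normedModType R) (rho drho : V -> R) (y : V),
    (forall z, 0 <= rho z) -> is_diff y rho drho ->
    is_diff y (fun z => f (rho z)) (fun v => f' (rho y) * drho v).

(* [x] ranges over the coordinates of the base, [row_mx x u] over those of the total
   space. [G] and [H] are the metrics of the base and of the fibres, [A x v q] is the
   covariant derivative along [v] of the section with constant components [q], and
   [H_diff] says that the connection is metric. *)
Section TotalMetric.
Context {R : realType} {n k : nat}.
Variables (Om : set 'rV[R]_n).
Hypothesis oOm : open Om.
Variables (G : 'rV[R]_n -> 'rV[R]_n -> 'rV[R]_n -> R)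
  (H : 'rV[R]_n -> 'rV[R]_k -> 'rV[R]_k -> R)
  (A : 'rV[R]_n -> 'rV[R]_n -> 'rV[R]_k -> 'rV[R]_k)
  (dA : 'rV[R]_n -> 'rV[R]_n -> 'rV[R]_k -> 'rV[R]_n -> 'rV[R]_k).
Hypotheses (G_diff : forall x a b, Om x -> differentiable (fun z => G z a b) x)
  (H_sym : forall x p q, H x p q = H x q p)
  (H_lin : forall x p, linear (H x p))
  (H_ge0 : forall x p, 0 <= H x p p)
  (A_linl : forall x q, linear (fun a => A x a q))
  (A_linr : forall x a, linear (A x a))
  (A_diff : forall x a q, Om x -> is_diff x (fun z => A z a q) (dA x a q))
  (H_diff : forall x p q, Om x -> is_diff x (fun z => H z p q)
     (fun v => H x (A x v p) q + H x p (A x v q))).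
Variables (f1 f1' f1'' f2 f2' f2'' : R -> R).
Hypotheses (hf1 : halfline_diff f1 f1') (hf1' : halfline_diff f1' f1'')
  (hf2 : halfline_diff f2 f2') (hf2' : halfline_diff f2' f2'').

Local Notation lp := (@lsubmx R 1 n k).
Local Notation rp := (@rsubmx R 1 n k).

Lemma H_Dr x p q q' : H x p (q + q') = H x p q + H x p q'.
Proof. by rewrite -[q in LHS]scale1r H_lin scale1r. Qed.
Lemma H_0r x p : H x p 0 = 0.
Proof. by apply: (addrI (H x p 0)); rewrite addr0 -H_Dr addr0. Qed.
Lemma H_Zr x p a q : H x p (a *: q) = a * H x p q.
Proof. by rewrite -[a *: q]addr0 H_lin H_0r addr0. Qed.
Lemma H_Nr x p q : H x p (- q) = - H x p q.
Proof. by rewrite -scaleN1r H_Zr mulN1r. Qed.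
Lemma H_Dl x p q q' : H x (q + q') p = H x q p + H x q' p.
Proof. by rewrite !(H_sym _ _ p) H_Dr. Qed.
Lemma H_0l x p : H x 0 p = 0.
Proof. by rewrite H_sym H_0r. Qed.
Lemma H_Zl x p a q : H x (a *: q) p = a * H x q p.
Proof. by rewrite !(H_sym _ _ p) H_Zr. Qed.
Lemma H_Nl x p q : H x (- q) p = - H x q p.
Proof. by rewrite !(H_sym _ _ p) H_Nr. Qed.
Lemma A_Dr x a p q : A x a (p + q) = A x a p + A x a q.
Proof. by rewrite -[p in LHS]scale1r A_linr scale1r. Qed.
Lemma A_0r x a : A x a 0 = 0.
Proof. by apply: (addrI (A x a 0)); rewrite addr0 -A_Dr addr0. Qed.
Lemma dA_0 x a v : Om x -> dA x a 0 v = 0.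
Proof.
move=> Ox; apply: (is_diff_uniq (f := fun z => A z a 0) (df' := fun _ => 0)).
  exact: A_diff.
rewrite (_ : (fun z => A z a 0) = cst 0); first exact: is_diff_cst.
by apply/funext => z; rewrite A_0r.
Qed.

(** The sums [A ... + dp] and [A ... + dq] are covariant derivatives along the moving base point, so
    no derivative of [H] itself remains. [is_diff_family] is applied to one fibre argument at a
    time. *)
Lemma is_diff_H (V : normedModType R) (x dx : V -> 'rV[R]_n)
    (p dp q dq : V -> 'rV[R]_k) y : Om (x y) ->
  is_diff y x dx -> is_diff y p dp -> is_diff y q dq ->
  is_diff y (fun z => H (x z) (p z) (q z))
    (fun e => H (x y) (A (x y) (dx e) (p y) + dp e) (q y)
            + H (x y) (p y) (A (x y) (dx e) (q y) + dq e)).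
Proof.
move=> Ox hx hp hq.
have h1 w : is_diff y (fun z => H (x z) (p z) w)
    (fun e => H (x y) (A (x y) (dx e) (p y) + dp e) w + H (x y) (p y) (A (x y) (dx e) w)).
  have lH z : linear (fun q => H z q w).
    by move=> a u v; rewrite H_Dl H_Zl.
  have hH q' : is_diff (x y) (fun z => H z q' w)
     (fun v => H (x y) (A (x y) v q') w + H (x y) q' (A (x y) v w)) by exact: H_diff.
  apply: is_diff_eq (is_diff_family lH hH hx hp) _.
  by apply/funext => e; rewrite H_Dl addrAC.
have lH z : linear (fun q => H (x z) (p z) q) by exact: H_lin.
apply: is_diff_eq (is_diff_family (L := fun z => H (x z) (p z)) lH h1 (is_diff_id y) hq) _.
by apply/funext => e; rewrite H_Dr addrA.
Qed.

Lemma is_diff_lsubmx y : is_diff y lp lp.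
Proof. by apply: rV_linear_is_diff => a u v; rewrite linearP. Qed.

Lemma is_diff_rsubmx y : is_diff y rp rp.
Proof. by apply: rV_linear_is_diff => a u v; rewrite linearP. Qed.

(* The vertical component of [a]: the horizontal space at [row_mx x u] consists of the
   vectors [row_mx v (- A x v u)]. *)
Definition vproj (a y : 'rV[R]_(n + k)) : 'rV[R]_k := rp a + A (lp y) (lp a) (rp y).

Definition sqnorm (y : 'rV[R]_(n + k)) : R := H (lp y) (rp y) (rp y).

Definition tmetric (a b y : 'rV[R]_(n + k)) : R :=
  f1 (sqnorm y) * G (lp y) (lp a) (lp b)
  + f2 (sqnorm y) * H (lp y) (vproj a y) (vproj b y).

(* Covariant derivative of [vproj a] in the direction [e]. *)
Definition vproj_deriv (e a y : 'rV[R]_(n + k)) : 'rV[R]_k :=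
  A (lp y) (lp e) (vproj a y) + (dA (lp y) (lp a) (rp y) (lp e) + A (lp y) (lp a) (rp e)).

(** The curvature form [dA + A /\ A] on constant vector fields, hence without a bracket term; the
    sign is that of [D_v D_w - D_w D_v]. *)
Definition curv (x v w : 'rV[R]_n) (q : 'rV[R]_k) : 'rV[R]_k :=
  dA x w q v - dA x v q w + A x v (A x w q) - A x w (A x v q).

Lemma is_diff_A (V : normedModType R) (x dx : V -> 'rV[R]_n) a
    (p dp : V -> 'rV[R]_k) y : Om (x y) -> is_diff y x dx -> is_diff y p dp ->
  is_diff y (fun z => A (x z) a (p z))
    (fun e => dA (x y) a (p y) (dx e) + A (x y) a (dp e)).
Proof.
move=> Ox hx hp.
exact: (is_diff_family (L := fun z => A z a) (fun z => A_linr z a)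
  (fun q => A_diff a q Ox) hx hp).
Qed.

Lemma is_diff_vproj a y : Om (lp y) ->
  is_diff y (vproj a)
    (fun e => dA (lp y) (lp a) (rp y) (lp e) + A (lp y) (lp a) (rp e)).
Proof.
move=> Oy; apply: is_diff_eq (is_diff_add (is_diff_const (rp a) y)
  (is_diff_A (lp a) Oy (is_diff_lsubmx y) (is_diff_rsubmx y))) _.
by apply/funext => e; rewrite add0r.
Qed.

(** A metric connection preserves the fibre norm in horizontal directions, so only the vertical
    component of [e] appears. *)
Lemma is_diff_sqnorm y : Om (lp y) ->
  is_diff y sqnorm (fun e => 2 * H (lp y) (vproj e y) (rp y)).
Proof.
move=> Oy; apply: is_diff_eq
  (is_diff_H Oy (is_diff_lsubmx y) (is_diff_rsubmx y) (is_diff_rsubmx y)) _.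
apply/funext => e; rewrite (H_sym _ (rp y)) -/(vproj _ _) addrC /vproj.
by rewrite [rp e + _]addrC; ring.
Qed.

Lemma sqnorm_ge0 y : 0 <= sqnorm y.
Proof. exact: H_ge0. Qed.

Lemma is_diff_G a b y : Om (lp y) ->
  is_diff y (fun z => G (lp z) a b) (fun e => 'd (fun x => G x a b) (lp y) (lp e)).
Proof.
move=> Oy; exact: (is_diff_compose (f := lp) (g := fun x => G x a b) erefl
  (is_diff_lsubmx y) (differentiableP (G_diff a b Oy))).
Qed.

Lemma is_diff_tmetric a b y : Om (lp y) ->
  is_diff y (tmetric a b) (fun e =>
    f1' (sqnorm y) * (2 * H (lp y) (vproj e y) (rp y)) * G (lp y) (lp a) (lp b)
    + f1 (sqnorm y) * 'd (fun x => G x (lp a) (lp b)) (lp y) (lp e)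
    + (f2' (sqnorm y) * (2 * H (lp y) (vproj e y) (rp y))
         * H (lp y) (vproj a y) (vproj b y)
       + f2 (sqnorm y) * (H (lp y) (vproj_deriv e a y) (vproj b y)
                          + H (lp y) (vproj a y) (vproj_deriv e b y)))).
Proof.
move=> Oy; have hr := is_diff_sqnorm Oy.
apply: is_diff_add.
  apply: (is_diff_mul (f := fun z => f1 (sqnorm z)) (g := fun z => G (lp z) (lp a) (lp b))).
    by apply: hf1 hr; exact: sqnorm_ge0.
  exact: is_diff_G.
apply: (is_diff_mul (f := fun z => f2 (sqnorm z))
   (g := fun z => H (lp z) (vproj a z) (vproj b z))).
  by apply: hf2 hr; exact: sqnorm_ge0.
exact: is_diff_H Oy (is_diff_lsubmx y) (is_diff_vproj a Oy) (is_diff_vproj b Oy).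
Qed.

(* The curvature of the bundle enters the Levi-Civita connection only through this
   failure of symmetry. *)
Lemma vproj_derivB e a y :
  vproj_deriv e a y = vproj_deriv a e y + curv (lp y) (lp e) (lp a) (rp y).
Proof.
rewrite /vproj_deriv /curv /vproj !A_Dr.
set x := lp y; set u := rp y.
set t1 := A x (lp e) (rp a); set t2 := A x (lp e) (A x (lp a) u).
set t3 := dA x (lp a) u (lp e); set t4 := A x (lp a) (rp e).
set t5 := A x (lp a) (A x (lp e) u); set t6 := dA x (lp e) u (lp a).
by apply/rowP => i; rewrite !mxE; ring.
Qed.

Local Notation GK := (koszul_of (fun a b x => G x a b)).

Lemma koszul_tmetric c a b y : Om (lp y) ->
  koszul_of tmetric c a b y =
  f1' (sqnorm y) * (H (lp y) (vproj c y) (rp y) * G (lp y) (lp a) (lp b)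
    + H (lp y) (vproj a y) (rp y) * G (lp y) (lp c) (lp b)
    - H (lp y) (vproj b y) (rp y) * G (lp y) (lp c) (lp a))
  + f1 (sqnorm y) * GK (lp c) (lp a) (lp b) (lp y)
  + f2' (sqnorm y) * (H (lp y) (vproj c y) (rp y) * H (lp y) (vproj a y) (vproj b y)
    + H (lp y) (vproj a y) (rp y) * H (lp y) (vproj c y) (vproj b y)
    - H (lp y) (vproj b y) (rp y) * H (lp y) (vproj c y) (vproj a y))
  + f2 (sqnorm y) * (2^-1 * (H (lp y) (vproj_deriv c a y + vproj_deriv a c y) (vproj b y)
      + H (lp y) (vproj a y) (curv (lp y) (lp c) (lp b) (rp y))
      + H (lp y) (vproj c y) (curv (lp y) (lp a) (lp b) (rp y)))).
Proof.
move=> Oy; have E p q := is_diffE (is_diff_tmetric p q Oy).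
apply: etrans (congr1 (fun t => 2^-1 * t) (congr2 (fun s t => s - t)
  (congr2 (fun s t => s + t) (E a b c) (E c b a)) (E c a b))) _.
(* [vproj_deriv c b] and [vproj_deriv a b] meet their transposes with opposite sign, so only
   curvature terms remain of these pairs. With the other vectors generalised, the goal is a
   polynomial identity. *)
rewrite (vproj_derivB c b) (vproj_derivB a b) /koszul_of.
move: (vproj_deriv c a y) (vproj_deriv a c y) (vproj_deriv b c y) (vproj_deriv b a y)
  (curv (lp y) (lp c) (lp b) (rp y)) (curv (lp y) (lp a) (lp b) (rp y))
  (vproj a y) (vproj b y) (vproj c y) => Qca Qac Qbc Qba Ocb Oab Pa Pb Pc.
move: ('d (fun x => G x (lp a) (lp b)) (lp y) (lp c))
  ('d (fun x => G x (lp c) (lp b)) (lp y) (lp a))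
  ('d (fun x => G x (lp c) (lp a)) (lp y) (lp b)) => t1 t2 t3.
rewrite !H_Dr !H_Dl (H_sym _ Pa Qbc).
by field.
Qed.

(** [H] is differentiated along [v] and [w] in both orders. The mixed products [H (A v p) (A w q)]
    and [H (A w p) (A v q)] occur in both and cancel; what is left is skewness. *)
Lemma curv_skew x v w p q : Om x ->
  H x (curv x v w p) q = - H x p (curv x v w q).
Proof.
move=> Ox.
have nO : \forall z \near x, Om z by exact: open_nbhs_nbhs.
have hA a r : is_diff x (fun z => A z a r) (dA x a r) by exact: A_diff.
have h u : is_diff x (fun z => 'd (fun z => H z p q) z u)
    (fun e => (H x (A x e (A x u p) + dA x u p e) q + H x (A x u p) (A x e q + 0))
      + (H x (A x e p + 0) (A x u q) + H x p (A x e (A x u q) + dA x u q e))).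
  have near_eq : \forall z \near x, H z (A z u p) q + H z p (A z u q) =
      'd (fun z => H z p q) z u.
    by apply: filterS nO => z Oz; exact/esym/(is_diffE (H_diff p q Oz)).
  apply: is_diff_near near_eq _.
  have h1 := is_diff_H (x := id) Ox (is_diff_id x) (hA u p) (is_diff_const q x).
  have h2 := is_diff_H (x := id) Ox (is_diff_id x) (is_diff_const p x) (hA u q).
  exact: is_diff_add h1 h2.
have dH : \forall z \near x, differentiable (fun z => H z p q) z.
  by apply: filterS nO => z Oz; have [] := H_diff p q Oz.
have := diff_diffC dH (ex_diff (is_diff_def := h v)) (ex_diff (is_diff_def := h w)).
move=> E; have {E} := etrans (esym (is_diffE (h v) w)) (etrans E (is_diffE (h w) v)).
rewrite !addr0 /curv !H_Dl !H_Dr !H_Nl !H_Nr => E.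
by lra.
Qed.

Lemma A_0l x q : A x 0 q = 0.
Proof. by have := A_linl x q (-1) 0 0; rewrite scaler0 add0r scaleN1r addNr. Qed.

Lemma curvC x v w q : curv x v w q = - curv x w v q.
Proof. by rewrite /curv; apply/rowP => i; rewrite !mxE; ring. Qed.

Lemma curv_0l x w q : Om x -> curv x 0 w q = 0.
Proof.
move=> Ox; rewrite /curv !A_0l A_0r.
have -> : dA x w q 0 = 0.
  by rewrite -(is_diffE (A_diff w q Ox)) linear0.
have -> : dA x 0 q w = 0.
  have h : is_diff x (fun z => A z 0 q) (fun _ => 0).
    rewrite (_ : (fun z => A z 0 q) = cst 0); first exact: is_diff_cst.
    by apply/funext => z; rewrite A_0l.
  exact: is_diff_uniq (A_diff 0 q Ox) h.
by rewrite !subr0 addr0.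
Qed.

Lemma curv_0r x v q : Om x -> curv x v 0 q = 0.
Proof. by move=> Ox; rewrite curvC curv_0l // oppr0. Qed.

Lemma curv_00 x v w : Om x -> curv x v w 0 = 0.
Proof. by move=> Ox; rewrite /curv !dA_0 // !A_0r !subr0 addr0. Qed.

Hypothesis dA_linr : forall x a v, linear (fun q => dA x a q v).

Lemma curv_linr x v w : linear (curv x v w).
Proof.
move=> a p q; rewrite /curv !dA_linr !A_linr.
by apply/rowP => i; rewrite !mxE; ring.
Qed.

(** * First-order expansions at a point of the zero section *)

Variable y0 : 'rV[R]_(n + k).
Hypotheses (Oy0 : Om (lp y0)) (ry0 : rp y0 = 0).
Hypothesis dA_diff : forall a q v, differentiable (fun z => dA z a q v) (lp y0).
Variable dGK : 'rV[R]_n -> 'rV[R]_n -> 'rV[R]_n -> 'rV[R]_n -> R.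
Hypothesis GK_diff : forall a b c, is_diff (lp y0) (GK a b c) (dGK a b c).

(** Existence of the derivative is enough: in [is_diff_curv0] it is multiplied by [u = 0]. *)
Lemma curv_diff v w q : differentiable (fun x => curv x v w q) (lp y0).
Proof.
have hA a : is_diff (lp y0) (fun z => A z a q) (dA (lp y0) a q) by exact: A_diff.
have hAA a b := is_diff_A b (x := id) (p := fun z => A z a q) Oy0 (is_diff_id _) (hA a).
have h1 := differentiableP (dA_diff w q v).
have h2 := differentiableP (dA_diff v q w).
have := is_diff_sub (is_diff_add (is_diff_sub h1 h2) (hAA w v)) (hAA v w).
by case.
Qed.

Lemma vproj0 a : vproj a y0 = rp a.
Proof. by rewrite /vproj ry0 A_0r addr0. Qed.

Lemma vproj_deriv0 e a :
  vproj_deriv e a y0 = A (lp y0) (lp e) (rp a) + A (lp y0) (lp a) (rp e).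
Proof. by rewrite /vproj_deriv vproj0 ry0 dA_0 // add0r. Qed.

Lemma sqnorm0 : sqnorm y0 = 0.
Proof. by rewrite /sqnorm ry0 H_0r. Qed.

Lemma is_diff_curv0 v w : is_diff y0 (fun z => curv (lp z) v w (rp z))
  (fun e => curv (lp y0) v w (rp e)).
Proof.
exact: (is_diff_family0 (L := fun z => curv z v w) (fun z => curv_linr z v w)
  (fun q => curv_diff v w q) (is_diff_lsubmx y0) (is_diff_rsubmx y0) ry0).
Qed.

(** The factor [dA] in [vproj_deriv] is applied to [u], so its own derivative is lost at [u = 0] and
    no second derivative of [A] appears. *)
Lemma is_diff_vproj_deriv0 c a : is_diff y0 (vproj_deriv c a)
  (fun e => (dA (lp y0) (lp c) (rp a) (lp e) + A (lp y0) (lp c) (A (lp y0) (lp a) (rp e)))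
   + (dA (lp y0) (lp a) (rp e) (lp c) + dA (lp y0) (lp a) (rp c) (lp e))).
Proof.
have h1 := is_diff_A (lp c) Oy0 (is_diff_lsubmx y0) (is_diff_vproj a Oy0).
have h2 := is_diff_family0 (L := fun z q => dA z (lp a) q (lp c))
  (fun z => dA_linr z (lp a) (lp c)) (fun q => dA_diff (lp a) q (lp c))
  (is_diff_lsubmx y0) (is_diff_rsubmx y0) ry0.
have h3 := is_diff_A (lp a) Oy0 (is_diff_lsubmx y0) (is_diff_const (rp c) y0).
apply: is_diff_eq (is_diff_add h1 (is_diff_add h2 h3)) _.
by apply/funext => e; rewrite vproj0 ry0 dA_0 // add0r A_0r addr0.
Qed.

Lemma is_diff_H0 (p dp q dq : 'rV[R]_(n + k) -> 'rV[R]_k) :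
  is_diff y0 p dp -> is_diff y0 q dq -> q y0 = 0 ->
  is_diff y0 (fun z => H (lp z) (p z) (q z)) (fun e => H (lp y0) (p y0) (dq e)).
Proof.
move=> hp hq q0; apply: is_diff_eq (is_diff_H Oy0 (is_diff_lsubmx y0) hp hq) _.
by apply/funext => e; rewrite q0 H_0r A_0r !add0r.
Qed.

(** The differential of [r] is a pairing with [u], zero here: to first order the radial coefficients
    are constants. *)
Lemma is_diff_comp_sqnorm f f' : halfline_diff f f' ->
  is_diff y0 (fun z => f (sqnorm z)) (fun _ => 0).
Proof.
move=> hf; have := hf _ sqnorm _ y0 sqnorm_ge0 (is_diff_sqnorm Oy0).
move/is_diff_eq; apply; apply/funext => e.
by rewrite ry0 H_0r !mulr0.
Qed.

Lemma is_diff_scale0 f f' (g dg : 'rV[R]_(n + k) -> R) : halfline_diff f f' ->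
  is_diff y0 g dg ->
  is_diff y0 (fun z => f (sqnorm z) * g z) (fun e => f 0 * dg e).
Proof.
move=> hf hg; apply: is_diff_eq (is_diff_mul (is_diff_comp_sqnorm hf) hg) _.
by apply/funext => e; rewrite sqnorm0 mul0r add0r.
Qed.

(** The factor [H(P_c, u)] vanishes at the zero section, so its derivative alone counts and that of
    [g] is lost. Such factors are the only source of the [f1'] and [f2'] terms. *)
Lemma is_diff_radial c (g dg : 'rV[R]_(n + k) -> R) : is_diff y0 g dg ->
  is_diff y0 (fun z => H (lp z) (vproj c z) (rp z) * g z)
    (fun e => H (lp y0) (rp c) (rp e) * g y0).
Proof.
move=> hg.
have hT := is_diff_H0 (is_diff_vproj c Oy0) (is_diff_rsubmx y0) ry0.
apply: is_diff_eq (is_diff_mul hT hg) _.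
by apply/funext => e; rewrite ry0 H_0r mul0r addr0 vproj0.
Qed.

(** The four summands of [koszul_tmetric], differentiated along [e]. The base part stays an abstract
    [dGK], to be recombined into the base curvature. *)
Definition koszul_deriv (c a b e : 'rV[R]_(n + k)) : R :=
  let x := lp y0 in
  f1' 0 * (H x (rp c) (rp e) * G x (lp a) (lp b)
         + H x (rp a) (rp e) * G x (lp c) (lp b)
         - H x (rp b) (rp e) * G x (lp c) (lp a))
  + f1 0 * dGK (lp c) (lp a) (lp b) (lp e)
  + f2' 0 * (H x (rp c) (rp e) * H x (rp a) (rp b)
           + H x (rp a) (rp e) * H x (rp c) (rp b)
           - H x (rp b) (rp e) * H x (rp c) (rp a))
  + f2 0 * (2^-1 * (
      (H x (A x (lp e) (A x (lp c) (rp a) + A x (lp a) (rp c)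
                      + (A x (lp a) (rp c) + A x (lp c) (rp a)))
          + ((dA x (lp c) (rp a) (lp e) + A x (lp c) (A x (lp a) (rp e))
              + (dA x (lp a) (rp e) (lp c) + dA x (lp a) (rp c) (lp e)))
            + (dA x (lp a) (rp c) (lp e) + A x (lp a) (A x (lp c) (rp e))
              + (dA x (lp c) (rp e) (lp a) + dA x (lp c) (rp a) (lp e))))) (rp b)
       + H x (A x (lp c) (rp a) + A x (lp a) (rp c)
              + (A x (lp a) (rp c) + A x (lp c) (rp a)))
           (A x (lp e) (rp b) + A x (lp b) (rp e)))
      + H x (rp a) (curv x (lp c) (lp b) (rp e))
      + H x (rp c) (curv x (lp a) (lp b) (rp e)))).

Lemma is_diff_koszul_tmetric c a b :
  is_diff y0 (koszul_of tmetric c a b) (koszul_deriv c a b).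
Proof.
have near_Om : \forall y \near y0, Om (lp y).
  have : lp y @[y --> y0] --> lp y0 by exact: continuous_lsubmx.
  by apply; exact: open_nbhs_nbhs.
apply: is_diff_near.
  by apply: filterS near_Om => y Oy; apply/esym; exact: koszul_tmetric Oy.
have hG a' b' := is_diff_G a' b' Oy0.
have hP a' := is_diff_vproj a' Oy0.
have hH a' b' := is_diff_H Oy0 (is_diff_lsubmx y0) (hP a') (hP b').
have hS := is_diff_add (is_diff_vproj_deriv0 c a) (is_diff_vproj_deriv0 a c).
have h1 := is_diff_sub (is_diff_add (is_diff_radial c (hG (lp a) (lp b)))
  (is_diff_radial a (hG (lp c) (lp b)))) (is_diff_radial b (hG (lp c) (lp a))).
have h2 := is_diff_compose (f := lp) (g := GK (lp c) (lp a) (lp b)) erefl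
  (is_diff_lsubmx y0) (GK_diff (lp c) (lp a) (lp b)).
have h3 := is_diff_sub (is_diff_add (is_diff_radial c (hH a b))
  (is_diff_radial a (hH c b))) (is_diff_radial b (hH c a)).
have c0 v w : curv (lp y0) v w (rp y0) = 0.
  by rewrite ry0 /curv !dA_0 // !A_0r !subr0 addr0.
have h4 := is_diff_add (is_diff_add (is_diff_H Oy0 (is_diff_lsubmx y0) hS (hP b))
    (is_diff_H0 (hP a) (is_diff_curv0 (lp c) (lp b)) (c0 _ _)))
    (is_diff_H0 (hP c) (is_diff_curv0 (lp a) (lp b)) (c0 _ _)).
have h5 := is_diff_mul (is_diff_const (2^-1 : R) y0) h4.
have h6 := is_diff_add (is_diff_add (is_diff_add (is_diff_scale0 hf1' h1)
  (is_diff_scale0 hf1 h2)) (is_diff_scale0 hf2' h3)) (is_diff_scale0 hf2 h5).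
apply: is_diff_eq h6 _; apply/funext => e /=.
by rewrite /koszul_deriv !vproj0 !vproj_deriv0 ry0 dA_0 // mul0r !add0r.
Qed.

(** Radial and curvature terms vanish with [u]. What remains describes [nabla_c a] at the zero
    section: its base part is that of [M], its vertical part [A(c1)a2 + A(a1)c2]. *)
Lemma koszul_tmetric0 c a b : koszul_of tmetric c a b y0 =
  f1 0 * GK (lp c) (lp a) (lp b) (lp y0)
  + f2 0 * H (lp y0) (A (lp y0) (lp c) (rp a) + A (lp y0) (lp a) (rp c)) (rp b).
Proof.
rewrite koszul_tmetric // !vproj0 !vproj_deriv0 sqnorm0 ry0 !H_0r.
have c0 v w : curv (lp y0) v w 0 = 0.
  by rewrite /curv !dA_0 // !A_0r !subr0 addr0.
rewrite !c0 !H_0r !mul0r !subr0 !addr0 !mulr0 add0r addr0.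
rewrite [X in H _ (_ + X)]addrC H_Dl; congr (_ + _ * _); by field.
Qed.

(** What [g(R(e, c)a, b)] contains besides the base curvature. Antisymmetrising in [e] and [c] makes
    the [f2'] products equal in pairs, hence the factor 2. *)
Definition curvature_formula (e c a b : 'rV[R]_(n + k)) : R :=
  let x := lp y0 in
  f1' 0 * (H x (rp a) (rp e) * G x (lp c) (lp b) - H x (rp b) (rp e) * G x (lp c) (lp a)
         - H x (rp a) (rp c) * G x (lp e) (lp b) + H x (rp b) (rp c) * G x (lp e) (lp a))
  + 2 * f2' 0 * (H x (rp a) (rp e) * H x (rp c) (rp b) - H x (rp b) (rp e) * H x (rp c) (rp a))
  + f2 0 * (H x (curv x (lp e) (lp c) (rp a)) (rp b)
    + 2^-1 * (H x (curv x (lp e) (lp a) (rp c)) (rp b)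
            - H x (curv x (lp c) (lp a) (rp e)) (rp b)
            + H x (rp a) (curv x (lp c) (lp b) (rp e))
            + H x (rp c) (curv x (lp a) (lp b) (rp e))
            - H x (rp a) (curv x (lp e) (lp b) (rp c))
            - H x (rp e) (curv x (lp a) (lp b) (rp c)))).

(* The products of Christoffel symbols of the vertical part cancel against the
   derivatives of [H]. *)
Lemma koszul_deriv_antisym e c a b : let x := lp y0 in
  koszul_deriv c a b e - koszul_deriv e a b c
  - f2 0 * H x (A x (lp c) (rp a) + A x (lp a) (rp c)) (A x (lp e) (rp b) + A x (lp b) (rp e))
  + f2 0 * H x (A x (lp e) (rp a) + A x (lp a) (rp e)) (A x (lp c) (rp b) + A x (lp b) (rp c))
  = f1 0 * (dGK (lp c) (lp a) (lp b) (lp e) - dGK (lp e) (lp a) (lp b) (lp c))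
    + curvature_formula e c a b.
Proof.
move=> x; rewrite /curvature_formula /koszul_deriv -/x.
rewrite /curv !A_Dr !H_Dl !H_Dr !H_Nl !H_Nr.
rewrite (H_sym x (rp e) (rp c)) (H_sym x (rp e) (rp a)) (H_sym x (rp a) (rp c))
  (H_sym x (rp e) (rp b)) (H_sym x (rp c) (rp b)).
by field.
Qed.

(** * Horizontal and vertical specialisations of the curvature formula *)

Local Notation hx := (fun p : 'rV[R]_n => row_mx p (0 : 'rV[R]_k)).
Local Notation vx := (fun q : 'rV[R]_k => row_mx (0 : 'rV[R]_n) q).
Local Notation x0 := (lp y0).

Hypothesis G_0l : forall p, G x0 0 p = 0.
Hypothesis G_0r : forall p, G x0 p 0 = 0.

Lemma curvature_formula_hhhh e c a b :
  curvature_formula (hx e) (hx c) (hx a) (hx b) = 0.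
Proof.
by rewrite /curvature_formula !row_mxKl !row_mxKr ?curv_00 ?curv_0r ?curv_0l // ?(H_0l, H_0r); ring.
Qed.

Lemma curvature_formula_hhhv e c a b :
  curvature_formula (hx e) (hx c) (hx a) (vx b) = 0.
Proof.
by rewrite /curvature_formula !row_mxKl !row_mxKr ?curv_00 ?curv_0r ?curv_0l // ?(H_0l, H_0r); ring.
Qed.

Lemma curvature_formula_hhvv e c a b :
  curvature_formula (hx e) (hx c) (vx a) (vx b) = f2 0 * H x0 (curv x0 e c a) b.
Proof.
rewrite /curvature_formula !row_mxKl !row_mxKr ?curv_00 ?curv_0r ?curv_0l // ?(H_0l, H_0r).
by ring.
Qed.

Lemma curvature_formula_hvhv e c a b :
  curvature_formula (hx e) (vx c) (hx a) (vx b) =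
  f1' 0 * G x0 e a * H x0 c b + 2^-1 * f2 0 * H x0 (curv x0 e a c) b.
Proof.
rewrite /curvature_formula !row_mxKl !row_mxKr ?curv_00 ?curv_0r ?curv_0l // ?(H_0l, H_0r).
by rewrite (H_sym x0 b c); ring.
Qed.

(** Two terms with coefficient 1/2 survive, and skewness of [curv] makes them equal. *)
Lemma curvature_formula_vvhh e c a b :
  curvature_formula (vx e) (vx c) (hx a) (hx b) = f2 0 * H x0 (curv x0 a b e) c.
Proof.
rewrite /curvature_formula !row_mxKl !row_mxKr ?(H_0l, H_0r).
by rewrite (H_sym x0 e) (curv_skew _ _ c e) // (H_sym x0 c); field.
Qed.

Lemma curvature_formula_vvvh e c a b :
  curvature_formula (vx e) (vx c) (vx a) (hx b) = 0.
Proof.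
rewrite /curvature_formula !row_mxKl !row_mxKr ?curv_00 ?curv_0r ?curv_0l // ?(H_0l, H_0r) ?G_0l.
by ring.
Qed.

Lemma curvature_formula_hvvv e c a b :
  curvature_formula (hx e) (vx c) (vx a) (vx b) = 0.
Proof.
rewrite /curvature_formula !row_mxKl !row_mxKr ?curv_00 ?curv_0r ?curv_0l // ?(H_0l, H_0r).
by rewrite ?G_0r; ring.
Qed.

Lemma curvature_formula_vvvv e c a b :
  curvature_formula (vx e) (vx c) (vx a) (vx b) =
  2 * f2' 0 * (H x0 a e * H x0 c b - H x0 b e * H x0 c a).
Proof.
rewrite /curvature_formula !row_mxKl !row_mxKr ?curv_00 ?curv_0r ?curv_0l // ?(H_0l, H_0r) ?G_0l.
by ring.
Qed.

End TotalMetric.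

(** * Sections and connections in a trivialisation *)

Section Smoothness.
Context {R : realType} {n : nat} {M : manifold R n}.

Lemma msmooth_of_chart (W : normedModType R) (f : M -> W) (U : set M) c :
  atlas c -> open U -> U `<=` cdom c -> smooth_on (cimg c U) (f \o cinv c) ->
  msmooth U f.
Proof.
move=> ac oU Uc hf d ad j; have hc := atlas_chart ac; have hd := atlas_chart ad.
have od := cimg_open hd oU.
apply: (@Ck_on_eq _ _ _ _ _ ((f \o cinv c) \o (cmap c \o cinv d))) => //.
  move=> y iy; have [Uy dy yE] := cimg_cinv hd iy.
  by rewrite /= (cmapK hc (Uc _ Uy)).
apply: (@Ck_on_comp _ _ _ _ _ _ (cimg c U)) => //.
  move=> y iy; have [Uy dy yE] := cimg_cinv hd iy.
  exact: cimg_cmap Uy (Uc _ Uy).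
by apply: Ck_on_sub (atlas_smooth ad ac j); apply: cimgS.
Qed.

Lemma vf_smooth_sub (X : vfield M) (U U' : set M) :
  U' `<=` U -> vf_smooth U X -> vf_smooth U' X.
Proof. by move=> sU hf d ad j; apply: Ck_on_sub (hf d ad j); exact: cimgS. Qed.

Lemma msmooth_cst (W : normedModType R) (w : W) (U : set M) :
  open U -> msmooth U (fun _ => w).
Proof. by move=> oU d ad j; apply: Ck_on_cst; exact: cimg_open (atlas_chart ad) _ oU. Qed.

End Smoothness.

Section Bundle.
Context {R : realType} {n k : nat} {M : manifold R n} (E : vbundle k M).
Local Notation V := (bundle_family E).
Implicit Types (t : ltriv (fib E) k) (c : chart R n M).

(* The section with constant components [q] in [t], extended by [0]. *)
Definition tsec t (q : 'rV[R]_k) : section V := fun x =>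
  if asbool (tdom t x) then xget 0 [set u | tcomp t u = q] else 0.

Lemma tsecK t q x : trivs t -> tdom t x -> tcomp t (tsec t q x) = q.
Proof.
move=> ht tx; rewrite /tsec asboolT //.
have [g gK Kg] := trivs_bij ht tx.
by apply: (@xgetPex _ 0 [set u | tcomp t u = q]); exists (g q); exact: Kg.
Qed.

Lemma tcomp_inj t x : trivs t -> tdom t x -> injective (@tcomp _ _ _ _ t x).
Proof. by move=> ht tx; exact/bij_inj/(trivs_bij ht tx). Qed.

Lemma tcompK t x (u : fib E x) : trivs t -> tdom t x -> tsec t (tcomp t u) x = u.
Proof. by move=> ht tx; apply: (tcomp_inj ht tx); exact: tsecK. Qed.

Lemma tcompP t x a (u v : fib E x) : trivs t -> tdom t x ->
  tcomp t (a *: u + v) = a *: tcomp t u + tcomp t v.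
Proof. by move=> ht tx; exact: trivs_linear. Qed.

Lemma tcompD t x (u v : fib E x) : trivs t -> tdom t x ->
  tcomp t (u + v) = tcomp t u + tcomp t v.
Proof. by move=> ht tx; rewrite -[u in LHS]scale1r tcompP // scale1r. Qed.

Lemma tcomp0 t x : trivs t -> tdom t x -> tcomp t (0 : fib E x) = 0.
Proof.
by move=> ht tx; apply: (addrI (tcomp t (0 : fib E x))); rewrite -tcompD // !addr0.
Qed.

Lemma tcompZ t x a (u : fib E x) : trivs t -> tdom t x ->
  tcomp t (a *: u) = a *: tcomp t u.
Proof. by move=> ht tx; rewrite -[a *: u]addr0 tcompP // tcomp0 // addr0. Qed.

Lemma tcomp_sum t x I (r : seq I) (f : I -> fib E x) : trivs t -> tdom t x ->
  tcomp t (\sum_(i <- r) f i) = \sum_(i <- r) tcomp t (f i).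
Proof.
move=> ht tx; elim: r => [|i r IH]; first by rewrite !big_nil tcomp0.
by rewrite !big_cons tcompD // IH.
Qed.

Lemma tsec_linear t x : trivs t -> linear (fun q => tsec t q x : fib E x).
Proof.
move=> ht a p q; have [tx|ntx] := pselect (tdom t x).
  by apply: (tcomp_inj ht tx); rewrite tcompP // !tsecK.
by rewrite /tsec asboolF // scaler0 addr0.
Qed.

(* The change of trivialisation is read off the transition map between the two charts
   that the trivialisations induce on the total space. *)
Lemma sec_smooth_of_triv t (s : section V) (U : set M) : trivs t -> open U ->
  U `<=` tdom t ->
  (forall c, atlas c -> smooth_on (cimg c U) (fun y => tcomp t (s (cinv c y)))) ->
  sec_smooth U s.
Proof.
move=> ht oU Ut hs c t' ac ht' j; have hc := atlas_chart ac.
have oU' : open (U `&` tdom t') by apply: openI => //; exact: trivs_open.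
have oc := cimg_open hc oU'.
have [d [ad dd dE]] := trivs_chart ht ac.
have [d' [ad' dd' dE']] := trivs_chart ht' ac.
have hd := atlas_chart ad.
(* [l] is the graph of [s] in the chart [d]; the transition to [d'] followed by [rsubmx] gives the
   components in [t']. *)
pose l y : 'rV[R]_(n + k) := row_mx y (tcomp t (s (cinv c y))).
have lE x : cdom c x -> U x -> l (cmap c x) = cmap d (pt (existT (fib E) x (s x))).
  by move=> cx Ux; rewrite /l (cmapK hc cx) dE //; exact: Ut.
have Cl : Ck_on j (cimg c (U `&` tdom t')) l.
  have Cs := Ck_on_sub (cimgS (@subIsetl _ U (tdom t'))) (hs c ac j).
  apply: (@Ck_on_eq _ _ _ _ _ (fun y => row_mx y 0 + row_mx 0 (tcomp t (s (cinv c y))))) => //.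
    by move=> y _; rewrite add_row_mx addr0 add0r.
  apply: Ck_onD => //.
    by apply: Ck_on_linear => // a u v; rewrite scale_row_mx add_row_mx scaler0 addr0.
  apply: (@Ck_on_comp _ _ _ _ _ _ setT _ (fun z => row_mx 0 z)) => //.
  apply: Ck_on_linear; first exact: openT.
  by move=> a u v; rewrite scale_row_mx add_row_mx scaler0 addr0.
have key : Ck_on j (cimg c (U `&` tdom t')) (rsubmx \o ((cmap d' \o cinv d) \o l)).
  apply: (@Ck_on_comp _ _ _ _ _ _ setT) => //; last first.
    by apply: Ck_on_linear; [exact: openT|move=> a u v; rewrite linearP].
  apply: (@Ck_on_comp _ _ _ _ _ _ (cimg d (cdom d'))) => //; last exact: atlas_smooth.
  move=> y [x [[Ux t'x] cx] <-]; rewrite lE //.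
  apply: cimg_cmap; first by rewrite dd' /= ptK.
  by rewrite dd /= ptK /=; split=> //; exact: Ut.
apply: Ck_on_eq key => // y [x [[Ux t'x] cx] <-] /=.
rewrite lE // (cmapK hd); last by rewrite dd /= ptK /=; split=> //; exact: Ut.
by rewrite dE' // row_mxKr (cmapK hc cx).
Qed.

Lemma sec_smooth_of_chart t c (s : section V) (U : set M) : trivs t -> atlas c ->
  open U -> U `<=` cdom c -> U `<=` tdom t ->
  smooth_on (cimg c U) (fun y => tcomp t (s (cinv c y))) -> sec_smooth U s.
Proof.
move=> ht ac oU Uc Ut hs; apply: (sec_smooth_of_triv ht) => // c' ac'.
exact: (msmooth_of_chart (f := fun x => tcomp t (s x)) ac oU Uc hs).
Qed.

Lemma tsec_smooth t q : trivs t -> sec_smooth (tdom t) (tsec t q).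
Proof.
move=> ht; apply: (sec_smooth_of_triv ht) => //; first exact: trivs_open.
move=> c ac j; have hc := atlas_chart ac.
have oc := cimg_open hc (trivs_open ht).
apply: Ck_on_eq (Ck_on_cst j q oc) => // y iy; have [ty _ _] := cimg_cinv hc iy.
by rewrite tsecK.
Qed.

Lemma sec_smooth_sub (s : section V) (U U' : set M) :
  U' `<=` U -> sec_smooth U s -> sec_smooth U' s.
Proof.
move=> sU hs c t ac ht j; apply: Ck_on_sub (hs c t ac ht j).
by apply: cimgS => x [/sU].
Qed.

Lemma sec_smoothD (s s' : section V) (U : set M) : open U ->
  sec_smooth U s -> sec_smooth U s' -> sec_smooth U (fun x => s x + s' x).
Proof.
move=> oU hs hs' c t ac ht j; have hc := atlas_chart ac.
have oc : open (cimg c (U `&` tdom t)).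
  by apply: cimg_open => //; apply: openI => //; exact: trivs_open.
apply: Ck_on_eq (Ck_onD oc (hs c t ac ht j) (hs' c t ac ht j)) => // y iy.
by have [[_ ty] _ _] := cimg_cinv hc iy; rewrite tcompD.
Qed.

Lemma sec_smoothZ (f : M -> R) (s : section V) (U : set M) : open U ->
  msmooth U f -> sec_smooth U s -> sec_smooth U (fun x => f x *: s x).
Proof.
move=> oU hf hs c t ac ht j; have hc := atlas_chart ac.
have oc : open (cimg c (U `&` tdom t)).
  by apply: cimg_open => //; apply: openI => //; exact: trivs_open.
have hf' := Ck_on_sub (cimgS (@subIsetl _ U (tdom t))) (hf c ac j).
apply: Ck_on_eq (Ck_onZ oc hf' (hs c t ac ht j)) => // y iy.
by have [[_ ty] _ _] := cimg_cinv hc iy; rewrite tcompZ.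
Qed.

Lemma sec_smooth0 (U : set M) : open U -> sec_smooth U (fun x => 0 : fib E x).
Proof.
move=> oU c t ac ht j; have hc := atlas_chart ac.
have oc : open (cimg c (U `&` tdom t)).
  by apply: cimg_open => //; apply: openI => //; exact: trivs_open.
apply: Ck_on_eq (Ck_on_cst j 0 oc) => // y iy.
by have [[_ ty] _ _] := cimg_cinv hc iy; rewrite tcomp0.
Qed.

Lemma sec_smooth_sum I (r : seq I) (s : I -> section V) (U : set M) : open U ->
  (forall i, sec_smooth U (s i)) -> sec_smooth U (fun x => \sum_(i <- r) s i x : fib E x).
Proof.
move=> oU hs; elim: r => [|i r IH].
  rewrite (_ : (fun x => _) = fun x => 0 : fib E x); first exact: sec_smooth0.
  by apply: functional_extensionality_dep => x; rewrite big_nil.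
rewrite (_ : (fun x => _) = fun x => s i x + \sum_(i <- r) s i x); first exact: sec_smoothD.
by apply: functional_extensionality_dep => x; rewrite big_cons.
Qed.

End Bundle.

Section Connection.
Context {R : realType} {n k : nat} {M : manifold R n} (E : vbundle k M).
Local Notation V := (bundle_family E).
Variables (D : connection V) (hD : is_connection D).
Implicit Types (p : M).

Lemma smooth_nearI (s : section V) p (U : set M) : open U -> U p ->
  sec_smooth U s -> smooth_near p s.
Proof. by move=> oU Up hs; exists U. Qed.

Lemma mdiff_cst (W : normedModType R) (w : W) p (v : tangent p) : mdiff (fun _ => w) v = 0.
Proof. exact: is_diffE (is_diff_cst w _) v. Qed.

Lemma connZ p (v : tangent p) a (s : section V) : smooth_near p s ->
  D v (fun x => a *: s x) = a *: D v s.
Proof.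
move=> hs; rewrite (@conn_leibniz _ _ _ _ _ hD p v (fun _ => a) s) //.
  by rewrite mdiff_cst scale0r add0r.
exists setT; first by split; [exact: openT|].
by apply: msmooth_cst; exact: openT.
Qed.

Lemma conn0 p (v : tangent p) : D v ((fun x => 0) : section V) = 0.
Proof.
have h : smooth_near p ((fun x => 0) : section V).
  exists setT; first by split; [exact: openT|].
  by apply: sec_smooth0; exact: openT.
have := connZ v 0 h; rewrite scale0r => <-.
by congr (D v _); apply: functional_extensionality_dep => x; rewrite scaler0.
Qed.

Lemma conn_dir0 p (s : section V) : smooth_near p s -> D (0 : tangent p) s = 0.
Proof.
move=> hs; have := conn_linear hD (-1) (0 : tangent p) (0 : tangent p) hs.
by rewrite scaler0 add0r scaleN1r addNr.
Qed.

Lemma conn_sum I (r : seq I) p (v : tangent p) (f : I -> M -> R) (s : I -> section V)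
    (U : set M) : open U -> U p -> (forall i, msmooth U (f i)) ->
  (forall i, sec_smooth U (s i)) ->
  D v (fun x => \sum_(i <- r) f i x *: s i x) =
  \sum_(i <- r) (mdiff (f i) v *: s i p + f i p *: D v (s i)).
Proof.
move=> oU Up hf hs; elim: r => [|i r IH].
  rewrite big_nil -[RHS](conn0 v); congr (D v _).
  by apply: functional_extensionality_dep => x; rewrite big_nil.
have Zs j : sec_smooth U (fun x => f j x *: s j x) by exact: sec_smoothZ.
rewrite big_cons -IH -(conn_leibniz hD); [|by exists U|exact: smooth_nearI (hs i)].
rewrite -(conn_add hD); last exact: (smooth_nearI oU Up (sec_smooth_sum r oU Zs)).
  by congr (D v _); apply: functional_extensionality_dep => x; rewrite big_cons.
exact: smooth_nearI (Zs i).
Qed.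

Variables (t : ltriv (fib E) k) (c : chart R n M).
Hypotheses (ht : trivs t) (ac : atlas c).
Let U := cdom c `&` tdom t.

Lemma open_trivchart : open U.
Proof. by apply: openI; [exact: open_cdom (atlas_chart ac)|exact: trivs_open]. Qed.

Lemma conn_triv p (v : tangent p) (s : section V) : U p -> smooth_near p s ->
  tcomp t (D v s) = 'd (fun y => tcomp t (s (cinv c y))) (cmap c p) (tcoord c v)
     + \sum_i (tcomp t (s p)) 0 i *: tcomp t (D v (tsec t 'e_i)).
Proof.
move=> Up hs; have [U1 [oU1 U1p] hs1] := hs; have [cp tp] := Up.
have hc := atlas_chart ac.
pose U2 := U1 `&` U.
have oU2 : open U2 by apply: openI => //; exact: open_trivchart.
have U2p : U2 p by [].
pose f i x := (tcomp t (s x)) 0 i.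
have Cs j : Ck_on j (cimg c U2) (fun y => tcomp t (s (cinv c y))).
  by apply: Ck_on_sub (hs1 c t ac ht j); apply: cimgS => x [? []].
have hf i : msmooth U2 (f i).
  apply: (msmooth_of_chart ac oU2) => [x [_ []]//|j].
  apply: (@Ck_on_comp _ _ _ _ _ _ setT (fun y => tcomp t (s (cinv c y))) (fun z => z 0 i)) => //.
    exact: cimg_open hc _ oU2.
  by apply: Ck_on_linear => [|a u w]; [exact: openT|rewrite !mxE].
have hts i : sec_smooth U2 (tsec t ('e_i : 'rV[R]_k)).
  by apply: sec_smooth_sub (tsec_smooth 'e_i ht) => x [_ []].
have sE x : tdom t x -> s x = \sum_i f i x *: tsec t 'e_i x.
  move=> tx; apply: (tcomp_inj ht tx).
  rewrite tcomp_sum // [in LHS](row_sum_delta (tcomp t (s x))).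
  by apply: eq_bigr => i _; rewrite tcompZ // tsecK.
(* The expansion in the frame holds on the domain of [t] only; locality of [D] permits the
   replacement. *)
have -> : D v s = D v (fun x => \sum_i f i x *: tsec t 'e_i x).
  apply: (conn_local hD) => //.
    exact: (smooth_nearI oU2 U2p (sec_smooth_sum _ oU2 (fun i => sec_smoothZ oU2 (hf i) (hts i)))).
  by apply: filterS (open_nbhs_nbhs (conj (trivs_open ht) tp)) => x; exact: sE.
rewrite (conn_sum _ _ oU2 U2p hf hts) tcomp_sum //.
have dS : differentiable (fun y => tcomp t (s (cinv c y))) (cmap c p).
  by have [h _] := Cs 1; apply: h; exact: cimg_cmap.
transitivity (\sum_i ('d (fun y => tcomp t (s (cinv c y))) (cmap c p) (tcoord c v) 0 i *: 'e_i
    + f i p *: tcomp t (D v (tsec t 'e_i)))); last first.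
  by rewrite big_split /= -row_sum_delta.
apply: eq_bigr => i _; rewrite tcompD // !tcompZ // tsecK //; congr (_ *: _ + _).
have h := is_diff_component i dS.
apply: etrans (mdiffE v ac cp (ex_diff (is_diff_def := h))) _.
exact: is_diffE h _.
Qed.

End Connection.

(** * The connection form and the fibre metric in a trivialisation over a chart *)

Section Coefficients.
Context {R : realType} {n k : nat} {M : manifold R n} (E : vbundle k M).
Local Notation V := (bundle_family E).
Variables (D : connection V) (hD : is_connection D).
Variables (gE : forall x : M, fib E x -> fib E x -> R)
  (hgE : is_metric (V := V) gE) (hDg : metric_compatible (V := V) gE D).
Variables (RE : forall x : M, tangent x -> tangent x -> fib E x -> fib E x)
  (hRE : is_curvature D RE).
Variables (t : ltriv (fib E) k) (c : chart R n M).
Hypotheses (ht : trivs t) (ac : atlas c).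
Let U := cdom c `&` tdom t.

Definition trivdom : set 'rV[R]_n := cimg c (cdom c `&` tdom t).

Lemma open_trivdom : open trivdom.
Proof. exact: cimg_open (atlas_chart ac) _ (open_trivchart ht ac). Qed.

(* Cut off outside [trivdom], so that linearity holds at every point. *)
Definition conn_coef (x v : 'rV[R]_n) (q : 'rV[R]_k) : 'rV[R]_k :=
  if asbool (trivdom x) then tcomp t (D (cfield c v (cinv c x)) (tsec t q)) else 0.

Definition conn_coef_diff (x v : 'rV[R]_n) (q : 'rV[R]_k) (w : 'rV[R]_n) : 'rV[R]_k :=
  if asbool (trivdom x) then 'd (fun z => conn_coef z v q) x w else 0.

Definition fmetric (x : 'rV[R]_n) (p q : 'rV[R]_k) : R :=
  gE (tsec t p (cinv c x)) (tsec t q (cinv c x)).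

Local Notation A := conn_coef.
Local Notation dA := conn_coef_diff.
Local Notation H := fmetric.

Lemma tsec_near p q : U p -> @smooth_near _ _ _ V p (tsec t q).
Proof.
move=> [cp tp]; exists (tdom t); last exact: tsec_smooth.
by split=> //; exact: trivs_open.
Qed.

Lemma conn_coefE x v q : trivdom x ->
  conn_coef x v q = tcomp t (D (cfield c v (cinv c x)) (tsec t q)).
Proof. by move=> Ox; rewrite /conn_coef asboolT. Qed.

Lemma conn_coefEp p v q : U p ->
  conn_coef (cmap c p) v q = tcomp t (D (cfield c v p) (tsec t q)).
Proof.
move=> Up; have [cp _] := Up; rewrite conn_coefE; last exact: cimg_cmap.
by rewrite (cmapK (atlas_chart ac) cp).
Qed.

Lemma conn_coef_linl x q : linear (fun v => A x v q).
Proof.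
move=> a v w; rewrite /conn_coef; case: asboolP => [Ox|_]; last by rewrite scaler0 addr0.
have [Ux cx xE] := cimg_cinv (atlas_chart ac) Ox.
rewrite cfieldD cfieldZ (conn_linear hD) ?tcompP //; first by have [] := Ux.
exact: tsec_near.
Qed.

Lemma conn_coef_linr x v : linear (A x v).
Proof.
move=> a p q; rewrite /conn_coef; case: asboolP => [Ox|_]; last by rewrite scaler0 addr0.
have [Ux cx xE] := cimg_cinv (atlas_chart ac) Ox; have [_ tx] := Ux.
rewrite -tcompP //; congr (tcomp t _).
have hp := tsec_near p Ux; have hq := tsec_near q Ux.
rewrite -(connZ hD _ _ hp).
have hap : @smooth_near _ _ _ V (cinv c x) (fun x => a *: tsec t p x).
  have [U1 oU1 h1] := hp; exists U1 => //; have [oU1' _] := oU1.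
  by apply: sec_smoothZ => //; exact: msmooth_cst.
rewrite -(conn_add hD) //; congr (D _ _).
by apply: functional_extensionality_dep => z; rewrite tsec_linear.
Qed.

Lemma conn_coef_smooth v q : smooth_on trivdom (fun x => A x v q).
Proof.
move=> j; have oU : open U := open_trivchart ht ac.
have hs : sec_smooth U (fun p => D (cfield c v p) (tsec t q)).
  apply: (conn_smooth hD) => //.
    by apply: vf_smooth_sub (cfield_smooth v ac) => x [].
  by apply: sec_smooth_sub (tsec_smooth q ht) => x [].
have h1 := hs c t ac ht j.
have UU : cimg c (U `&` tdom t) = trivdom.
  by rewrite /trivdom -setIA setIid.
rewrite UU in h1; apply: Ck_on_eq open_trivdom _ h1 => x Ox.
by rewrite conn_coefE.
Qed.

Lemma is_diff_conn_coef x v q : trivdom x -> is_diff x (fun z => A z v q) (dA x v q).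
Proof.
move=> Ox; have [h _] := conn_coef_smooth v q 1.
apply: is_diff_eq (differentiableP (h x Ox)) _.
by apply/funext => w; rewrite /conn_coef_diff asboolT.
Qed.

Lemma conn_coef_diff_differentiable x v q w : trivdom x ->
  differentiable (fun z => dA z v q w) x.
Proof.
move=> Ox; have [_ h] := conn_coef_smooth v q 2; have [h1 _] := h w.
apply: near_differentiable (h1 x Ox).
apply: filterS (open_nbhs_nbhs (conj open_trivdom Ox)) => z Oz.
by rewrite /conn_coef_diff asboolT.
Qed.

Lemma conn_coef_diff_linr x v w : linear (fun q => dA x v q w).
Proof.
move=> a p q; have [Ox|nO] := pselect (trivdom x); last first.
  by rewrite /conn_coef_diff asboolF // scaler0 addr0.
have h := is_diff_add (is_diff_scale (is_diff_const a x) (is_diff_conn_coef v p Ox))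
  (is_diff_conn_coef v q Ox).
apply: etrans (is_diff_uniq (f := fun z => A z v (a *: p + q)) w (is_diff_conn_coef v _ Ox) _) _.
  rewrite (_ : (fun z => _) = (fun z => a *: A z v p + A z v q)); first exact: h.
  by apply/funext => z; rewrite conn_coef_linr.
by rewrite /= scale0r add0r.
Qed.

Lemma conn_coordE p (v : tangent p) (s : section V) : U p -> smooth_near p s ->
  tcomp t (D v s) = 'd (fun y => tcomp t (s (cinv c y))) (cmap c p) (tcoord c v)
     + A (cmap c p) (tcoord c v) (tcomp t (s p)).
Proof.
move=> Up hs; apply: etrans (conn_triv hD ht ac v Up hs) _; congr (_ + _).
have [cp tp] := Up.
pose fM := GRing.isLinear.Build _ _ _ _ _ (conn_coef_linr (cmap c p) (tcoord c v)).
pose F : {linear 'rV[R]_k -> 'rV[R]_k} := HB.pack (A (cmap c p) (tcoord c v)) fM.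
rewrite -[A _ _]/(F : _ -> _) [in RHS](row_sum_delta (tcomp t (s p))) linear_sum.
apply: eq_bigr => i _; rewrite linearZ /=; congr (_ *: _).
by rewrite conn_coefEp // cfieldK.
Qed.

Lemma fmetric_sym x p q : H x p q = H x q p.
Proof. by have [h _ _ _] := hgE; rewrite /fmetric h. Qed.

Lemma fmetric_lin x p : linear (H x p).
Proof.
have [hs hl _ _] := hgE; move=> a q r.
by rewrite !(fmetric_sym _ p) /fmetric tsec_linear // hl.
Qed.

Lemma fmetric_ge0 x p : 0 <= H x p p.
Proof.
have [hs hl hp _] := hgE; rewrite /fmetric; set u := tsec _ _ _.
have [->|u0] := eqVneq u 0; last by rewrite ltW // hp.
have := hl (cinv c x) (-1) 0 0 0; rewrite scaler0 addr0 mulN1r addNr => ->.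
exact: lexx.
Qed.

Lemma fmetricE p (u v : fib E p) : U p ->
  gE u v = H (cmap c p) (tcomp t u) (tcomp t v).
Proof.
move=> [cp tp]; rewrite /fmetric (cmapK (atlas_chart ac) cp).
by rewrite !tcompK.
Qed.

Lemma is_diff_fmetric x p q : trivdom x ->
  is_diff x (fun z => H z p q) (fun v => H x (A x v p) q + H x p (A x v q)).
Proof.
move=> Ox; have [Ux cx xE] := cimg_cinv (atlas_chart ac) Ox; have [_ tx] := Ux.
have [_ _ _ hsm] := hgE.
have hdiff : differentiable ((fun y => gE (tsec t p y) (tsec t q y)) \o cinv c) (cmap c (cinv c x)).
  have sm r : sec_smooth U (tsec t r).
    by apply: sec_smooth_sub (tsec_smooth r ht) => y [].
  have [h _] := hsm U _ _ (open_trivchart ht ac) (sm p) (sm q) c ac 1.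
  by apply: h; rewrite xE.
have key v : 'd (fun z => H z p q) x v = H x (A x v p) q + H x p (A x v q).
  have := hDg (cfield c v (cinv c x)) (tsec_near p Ux) (tsec_near q Ux).
  move=> E1; have {E1} := etrans (esym (mdiff_cfield v ac cx hdiff)) E1.
  rewrite xE => E1; apply: etrans E1 _.
  by rewrite /fmetric !conn_coefE // !tcompK.
apply: DiffDef; last by apply/funext => v; exact: key.
by rewrite -xE.
Qed.

(** [RE] depends on values at [p] only, so it may be evaluated on coordinate fields and a section
    with constant components. The bracket vanishes and each second derivative is a [dA] term plus a
    product of two [A]. *)
Lemma curvature_triv p (v w : tangent p) (u : fib E p) : U p ->
  tcomp t (RE v w u) = curv A dA (cmap c p) (tcoord c v) (tcoord c w) (tcomp t u).
Proof.
move=> Up; have [cp tp] := Up; have oU := open_trivchart ht ac.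
have Op : trivdom (cmap c p) by exact: cimg_cmap.
set a := tcoord c v; set b := tcoord c w; set q := tcomp t u.
rewrite -(cfieldK v ac cp) -(cfieldK w ac cp) -(tcompK u ht tp) -/a -/b -/q.
have cs a' : exists2 W, open_nbhs p W & vf_smooth W (cfield c a').
  exists (cdom c); last exact: cfield_smooth.
  by split=> //; exact: open_cdom (atlas_chart ac).
rewrite (hRE (cs a) (cs b) (tsec_near q Up)) (lie_cfield _ _ ac cp).
rewrite (conn_dir0 hD (tsec_near q Up)) subr0.
have sm a' : sec_smooth U (fun z => D (cfield c a' z) (tsec t q)).
  apply: (conn_smooth hD) => //.
    by apply: vf_smooth_sub (cfield_smooth a' ac) => x [].
  by apply: sec_smooth_sub (tsec_smooth q ht) => x [].
have key a' b' : tcomp t (D (cfield c a' p) (fun z => D (cfield c b' z) (tsec t q)))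
    = dA (cmap c p) b' q a' + A (cmap c p) a' (A (cmap c p) b' q).
  have hs : @smooth_near _ _ _ V p (fun z => D (cfield c b' z) (tsec t q)).
    by exists U => [|]; [split|exact: sm].
  apply: etrans (conn_coordE _ Up hs) _.
  rewrite tcoord_cfield // (conn_coefEp b' q Up); congr (_ + _).
  have ne : \forall y \near cmap c p, A y b' q =
      tcomp t (D (cfield c b' (cinv c y)) (tsec t q)).
    by apply: filterS (open_nbhs_nbhs (conj open_trivdom Op)) => y Oy; rewrite conn_coefE.
  exact: is_diffE (is_diff_near ne (is_diff_conn_coef b' q Op)) a'.
rewrite -scaleN1r addrC tcompP // !key scaleN1r /curv.
by apply/rowP => i; rewrite !mxE; ring.
Qed.

End Coefficients.

(** * Tangent vectors of the total space *)

Section TangentMaps.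
Context {R : realType}.

(** The image point is a separate variable: [tangent] is the same row space at every point, so the
    equation is well typed although [f p] and [e] are only propositionally equal. *)
Lemma tmapE m n (M : manifold R m) (N : manifold R n) (f : M -> N) c d p
    (v : tangent p) e : f p = e ->
  atlas c -> atlas d -> cdom c p -> (\forall q \near p, cdom d (f q)) ->
  differentiable (cmap d \o f \o cinv c) (cmap c p) ->
  tmap f v = cfield d ('d (cmap d \o f \o cinv c) (cmap c p) (tcoord c v)) e.
Proof.
move=> <- ac ad cp nf df; have hc := atlas_chart ac; have hd := atlas_chart ad.
have dfp : cdom d (f p) := nbhs_singleton nf.
have d1 := differentiableP df.
have d2 := differentiableP (transition_diff ad (mchart_atlas (f p)) dfp (mchart_dom (f p))).
have h3 : is_diff (cmap c p) ((cmap (mchart (f p)) \o cinv d) \o (cmap d \o f \o cinv c))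
    ('d (cmap (mchart (f p)) \o cinv d) (cmap d (f p)) \o 'd (cmap d \o f \o cinv c) (cmap c p)).
  by apply: is_diff_compose d1 d2; rewrite /= (cmapK hc cp).
have ne : \forall y \near cmap c p,
    ((cmap (mchart (f p)) \o cinv d) \o (cmap d \o f \o cinv c)) y
    = ((cmap (mchart (f p)) \o f) \o cinv c) y.
  by apply: filterS (near_cinv hc cp nf) => y dy /=; rewrite (cmapK hd dy).
have h4 := is_diff_near ne h3.
rewrite /tmap; apply: etrans (mdiffE v ac cp (ex_diff (is_diff_def := h4))) _.
apply: etrans (is_diffE h4 _) _.
by rewrite /cfield asboolT.
Qed.

Lemma velocityE n (N : manifold R n) (g : R -> N) d e : g 0 = e ->
  atlas d -> (forall s, cdom d (g s)) -> differentiable (cmap d \o g) 0 ->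
  velocity g = cfield d ('d (cmap d \o g) 0 1) e.
Proof.
move=> <- ad dg df; have hd := atlas_chart ad.
have d1 := differentiableP df.
have d2 := differentiableP (transition_diff ad (mchart_atlas (g 0)) (dg 0) (mchart_dom (g 0))).
have h3 := is_diff_compose (f := cmap d \o g) (x := 0) erefl d1 d2.
have E : (cmap (mchart (g 0)) \o cinv d) \o (cmap d \o g) = cmap (mchart (g 0)) \o g.
  by apply/funext => s /=; rewrite (cmapK hd (dg s)).
rewrite E in h3; rewrite /velocity.
apply: etrans (derive1E' (ex_diff (is_diff_def := h3))) _.
apply: etrans (is_diffE h3 _) _.
by rewrite /cfield asboolT.
Qed.

End TangentMaps.

Section TotalSpace.
Context {R : realType} {n k : nat} {M : manifold R n} (E : vbundle k M).
Local Notation V := (bundle_family E).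
Local Notation T := (total_space E).
Variables (D : connection V) (hD : is_connection D).
Variables (gM : forall x : M, tangent x -> tangent x -> R)
  (gE : forall x : M, fib E x -> fib E x -> R)
  (hgE : is_metric (V := V) gE).
Variables (t : ltriv (fib E) k) (c : chart R n M) (d : chart R (n + k) T).
Hypotheses (ht : trivs t) (ac : atlas c) (ad : atlas d)
  (dd : cdom d = [set e | cdom c (tag (unpt e)) /\ tdom t (tag (unpt e))])
  (dE : forall x (u : fib E x), cdom c x -> tdom t x ->
     cmap d (pt (existT _ x u)) = row_mx (cmap c x) (tcomp t u)).
Let hc := atlas_chart ac.
Let hd := atlas_chart ad.
Local Notation A := (conn_coef D t c).
Local Notation lp := (@lsubmx R 1 n k).
Local Notation rp := (@rsubmx R 1 n k).

Lemma pt_base_fvec (e : T) : pt (existT (fib E) (base e) (fvec e)) = e.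
Proof. by rewrite /base /fvec; case: (unpt e) (unptK e) => x u /=. Qed.

Lemma cdom_total (e : T) : cdom d e <-> cdom c (base e) /\ tdom t (base e).
Proof. by rewrite dd. Qed.

Lemma cmap_total (e : T) : cdom d e ->
  cmap d e = row_mx (cmap c (base e)) (tcomp t (fvec e)).
Proof. by move=> /cdom_total[ce te]; rewrite -[in LHS](pt_base_fvec e) dE. Qed.

Lemma base_pt x (u : fib E x) : base (pt (existT (fib E) x u)) = x.
Proof. by rewrite /base ptK. Qed.

Lemma tcoord_vlift (e : T) (w : fib E (base e)) : cdom d e ->
  tcoord d (vlift w) = row_mx 0 (tcomp t w).
Proof.
move=> de; have /cdom_total[ce te] := de.
pose g s : T := pt (existT (fib E) (base e) (fvec e + s *: w)).
have g0 : g 0 = e by rewrite /g scale0r addr0 pt_base_fvec.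
have dg s : cdom d (g s) by apply/cdom_total; rewrite base_pt.
have hg : is_diff 0 (cmap d \o g) (fun s => s *: row_mx 0 (tcomp t w)).
  have -> : cmap d \o g =
     fun s => row_mx (cmap c (base e)) (tcomp t (fvec e)) + s *: row_mx 0 (tcomp t w).
    apply/funext => s /=; rewrite /g dE // tcompD // tcompZ //.
    by rewrite scale_row_mx add_row_mx scaler0 addr0.
  apply: is_diff_eq (is_diff_add (is_diff_const _ _) (is_diff_scalel _ _)) _.
  by apply/funext => s; rewrite add0r.
have -> : vlift w = cfield d (row_mx 0 (tcomp t w)) e.
  apply: etrans (velocityE g0 ad dg (ex_diff (is_diff_def := hg))) _.
  by congr (cfield d _ e); rewrite (is_diffE hg) scale1r.
exact: tcoord_cfield.
Qed.

Lemma near_base_U p : cdom c p -> tdom t p ->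
  \forall q \near p, cdom c q /\ tdom t q.
Proof. by move=> cp tp; exact: (open_nbhs_nbhs (conj (open_trivchart ht ac) (conj cp tp))). Qed.

Lemma tmap_section p (v : tangent p) (s : section V) e :
  pt (existT (fib E) p (s p)) = e -> cdom c p -> tdom t p -> smooth_near p s ->
  tmap (fun x => pt (existT (fib E) x (s x))) v =
  cfield d (row_mx (tcoord c v) ('d (fun y => tcomp t (s (cinv c y))) (cmap c p) (tcoord c v))) e.
Proof.
move=> pe cp tp hs.
set f := fun x => pt _; set sig := fun y => tcomp t _.
have hsig : differentiable sig (cmap c p).
  have [U [oU Up] hU] := hs; have [h _] := hU c t ac ht 1.
  by apply: h; exact: cimg_cmap.
have nf : \forall q \near p, cdom d (f q).
  by apply: filterS (near_base_U cp tp) => q cq; apply/cdom_total; rewrite base_pt.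
have hf : is_diff (cmap c p) (cmap d \o f \o cinv c) (fun w => row_mx w ('d sig (cmap c p) w)).
  have ne : \forall y \near cmap c p, row_mx y 0 + row_mx 0 (sig y) = (cmap d \o f \o cinv c) y.
    have h1 := near_cinv hc cp (near_base_U cp tp).
    have h2 := near_cimg hc cp openT I.
    apply: filterS (filterI h1 h2) => y [[cy ty] iy] /=.
    rewrite /f dE // add_row_mx addr0 add0r.
    by have [_ _ ->] := cimg_cinv hc iy.
  apply: is_diff_near ne _.
  have l1 : linear (fun y : 'rV[R]_n => row_mx y (0 : 'rV[R]_k)).
    by move=> a u w; rewrite scale_row_mx add_row_mx scaler0 addr0.
  have l2 : linear (fun y : 'rV[R]_k => row_mx (0 : 'rV[R]_n) y).
    by move=> a u w; rewrite scale_row_mx add_row_mx scaler0 addr0.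
  have i2 := is_diff_compose (f := sig) (g := fun y : 'rV[R]_k => row_mx (0 : 'rV[R]_n) y) erefl
    (differentiableP hsig) (rV_linear_is_diff _ l2).
  apply: is_diff_eq (is_diff_add (rV_linear_is_diff _ l1) i2) _.
  by apply/funext => w; rewrite /= add_row_mx addr0 add0r.
apply: etrans (tmapE v pe ac ad cp nf (ex_diff (is_diff_def := hf))) _.
by congr (cfield d _ e); exact: is_diffE hf _.
Qed.

(** A section moves in coordinates with velocity [(v, ds(v))], and [D_v s = ds(v) + A(v)u]; being
    parallel thus fixes the fibre part. *)
Lemma horizontalP (e : T) (xi : tangent e) : cdom d e ->
  horizontal D xi <->
  rp (tcoord d xi) = - A (cmap c (base e)) (lp (tcoord d xi)) (tcomp t (fvec e)).
Proof.
move=> de; have /cdom_total[ce te] := de.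
have Ue : (cdom c `&` tdom t) (base e) by [].
split=> [[v [s [hs se Ds xiE]]]|xiE].
  have pe : pt (existT (fib E) (base e) (s (base e))) = e by rewrite se pt_base_fvec.
  have E1 := tmap_section v pe ce te hs.
  have -> : xi = tmap (fun x => pt (existT (fib E) x (s x))) v by exact: xiE.
  rewrite E1 (tcoord_cfield _ ad de) row_mxKl row_mxKr.
  have := conn_coordE hD ht ac v Ue hs; rewrite Ds tcomp0 // se => E2.
  by apply/eqP; rewrite -addr_eq0; apply/eqP; rewrite -E2.
(* Conversely, the section that is affine in the coordinates, with value [u] and
   differential [- A x _ u] at [x], is parallel at [x] in every direction. *)
set a := lp (tcoord d xi) in xiE *; set u := tcomp t (fvec e) in xiE *.
set x := cmap c (base e) in xiE *.
pose L w : 'rV[R]_k := A x w u.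
have LL : linear L by move=> b w w'; exact: conn_coef_linl.
pose sig (y : 'rV[R]_n) : 'rV[R]_k := u - L (y - x).
pose s : section V := fun q => tsec t (sig (cmap c q)) q.
have oU := open_trivchart ht ac.
have hsm : sec_smooth (cdom c `&` tdom t) s.
  apply: (sec_smooth_of_chart (t := t) (c := c)) => // j.
  have oc := cimg_open hc oU.
  apply: (@Ck_on_eq _ _ _ _ _ (fun y => (u + L x) + (-1) *: L y)) => //.
    move=> y iy; have [[cy ty] _ yE] := cimg_cinv hc iy.
    rewrite /s tsecK // yE /sig scaleN1r.
    have -> : L (y - x) = L y - L x.
      by rewrite addrC -scaleN1r LL scaleN1r addrC.
    by rewrite opprB addrA.
  apply: Ck_onD => //; first exact: Ck_on_cst.
  apply: Ck_on_linear => // b w w'.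
  by rewrite LL scalerDr !scalerA mulrC.
have hs : smooth_near (base e) s by exists (cdom c `&` tdom t).
have L0 : L 0 = 0.
  by have := LL (-1) 0 0; rewrite scaler0 add0r scaleN1r addNr.
have se : s (base e) = fvec e.
  by rewrite /s /sig subrr L0 subr0 tcompK.
have pe : pt (existT (fib E) (base e) (s (base e))) = e by rewrite se pt_base_fvec.
have dsig : is_diff x (fun y => tcomp t (s (cinv c y))) (fun w => - L w).
  have ne : \forall y \near x, sig y = tcomp t (s (cinv c y)).
    have iU : \forall y \near x, cimg c (cdom c `&` tdom t) y by exact: near_cimg.
    apply: filterS iU => y iy; have [[cy ty] _ yE] := cimg_cinv hc iy.
    by rewrite /s tsecK // yE.
  apply: is_diff_near ne _.
  have i1 := is_diff_sub (is_diff_id x) (is_diff_const x x).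
  have i2 := is_diff_compose (f := fun y => y - x) (g := L) erefl i1 (rV_linear_is_diff _ LL).
  apply: is_diff_eq (is_diff_sub (is_diff_const u x) i2) _.
  by apply/funext => w /=; rewrite sub0r subr0.
pose v : tangent (base e) := cfield c a (base e).
have va : tcoord c v = a by exact: tcoord_cfield.
exists v, s; split=> //.
  apply: (tcomp_inj ht te); rewrite tcomp0 //.
  apply: etrans (conn_coordE hD ht ac v Ue hs) _.
  by rewrite (is_diffE dsig) va se addNr.
apply: (tcoord_inj ad de).
have E1 := tmap_section v pe ce te hs.
rewrite E1 (tcoord_cfield _ ad de) (is_diffE dsig) va -xiE.
by rewrite /a hsubmxK.
Qed.

(** Horizontality of [xi - vlift w'] is an equation for [tcomp t w'] with exactly one solution, so
    the default case of [xget] is never taken. *)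
Lemma tcoord_vcomp (e : T) (xi : tangent e) : cdom d e ->
  tcomp t (vcomp D xi) =
  vproj A (tcoord d xi) (cmap d e).
Proof.
move=> de; have /cdom_total[ce te] := de.
rewrite /vproj cmap_total // row_mxKl row_mxKr.
set w := _ + _.
have key w' : horizontal D (xi - vlift w' : tangent e) <-> tcomp t w' = w.
  apply: iff_trans (horizontalP _ de) _.
  have -> : tcoord d (xi - vlift w' : tangent e) = tcoord d xi - row_mx 0 (tcomp t w').
    by rewrite tcoordD tcoordN tcoord_vlift.
  rewrite !linearB /= row_mxKl row_mxKr subr0; split.
    by move/eqP; rewrite subr_eq addrC eq_sym subr_eq => /eqP ->.
  by move=> ->; rewrite /w opprD addrA subrr sub0r.
apply/key; rewrite /vcomp.
apply: (@xgetPex _ 0 [set w' | horizontal D (xi - vlift w' : tangent e)]).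
by exists (tsec t w (base e)); apply/key; rewrite tsecK.
Qed.

Lemma tcoord_vpart (e : T) (xi : tangent e) : cdom d e ->
  tcoord d (vpart D xi) = row_mx 0 (vproj A (tcoord d xi) (cmap d e)).
Proof. by move=> de; rewrite tcoord_vlift // tcoord_vcomp. Qed.

Lemma tcoord_hpart (e : T) (xi : tangent e) : cdom d e ->
  tcoord d (hpart D xi) = tcoord d xi - row_mx 0 (vproj A (tcoord d xi) (cmap d e)).
Proof. by move=> de; rewrite /hpart tcoordD tcoordN tcoord_vpart. Qed.

Lemma tcoord_hcomp (e : T) (xi : tangent e) : cdom d e ->
  tcoord c (hcomp D xi) = lp (tcoord d xi).
Proof.
move=> de; have /cdom_total[ce te] := de.
have nf : \forall e' \near e, cdom c (base e').
  by apply: filterS (open_nbhs_nbhs (conj (open_cdom hd) de)) => e' /cdom_total[].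
have hb : is_diff (cmap d e) (cmap c \o @base _ _ _ _ E \o cinv d) lp.
  have ne : \forall y \near cmap d e, lp y = (cmap c \o @base _ _ _ _ E \o cinv d) y.
    apply: filterS (near_cimg hd de openT I) => y iy.
    have [_ dy yE] := cimg_cinv hd iy.
    by rewrite -[in LHS]yE cmap_total // row_mxKl.
  exact: is_diff_near ne (is_diff_lsubmx _).
have -> : hcomp D xi = cfield c (lp (tcoord d (hpart D xi))) (base e).
  apply: etrans (tmapE (hpart D xi) erefl ad ac de nf (ex_diff (is_diff_def := hb))) _.
  by congr (cfield c _ (base e)); exact: is_diffE hb _.
by rewrite tcoord_cfield // tcoord_hpart // linearB /= row_mxKl subr0.
Qed.

Lemma total_metricE phi1 phi2 (e : T) (X Y : tangent e) : cdom d e ->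
  total_metric D gM gE phi1 phi2 X Y =
  tmetric (fun x a b => metric_coord gM c a b x) (fmetric gE t c) A
    (fun r => expR (2 * phi1 r)) (fun r => expR (2 * phi2 r))
    (tcoord d X) (tcoord d Y) (cmap d e).
Proof.
move=> de; have /cdom_total[ce te] := de.
have Ue : (cdom c `&` tdom t) (base e) by [].
rewrite /total_metric /tmetric /sqnorm /pairM /pairE.
rewrite -!tcoord_vcomp // cmap_total // row_mxKl row_mxKr -!tcoord_hcomp //.
rewrite -!(fmetricE gE ht ac _ _ Ue).
congr (_ * _ + _); exact/esym/metric_coordE.
Qed.

End TotalSpace.

(** * Functions on the half-line *)

Section Halfline.
Context {R : realType}.

Lemma is_diff_of_bound (f : R -> R) (L r : R) :
  (forall e, 0 < e -> \forall s \near r, `|f s - f r - L * (s - r)| <= e * `|s - r|) ->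
  is_diff r f (fun v => L * v).
Proof.
move=> hf.
have lL : linear (fun v : R => L * v).
  by move=> a u v; rewrite mulrDr -[a *: u]/(a * u) mulrCA.
pose fM := GRing.isLinear.Build _ _ _ _ _ lL.
pose F : {linear R -> R} := HB.pack (fun v : R => L * v) fM.
have cF : continuous F by move=> x; exact: mulrl_continuous.
have E : f \o shift r = cst (f r) + F +o_ 0 id.
  apply/eqaddoP => e e0; have := hf e e0; rewrite (near_shift 0 r) /= subr0.
  apply: filterS => s /=; rewrite addrK => h.
  by rewrite !fctE /= opprD addrA.
have dE : 'd f r = F :> (R -> R) by exact: diff_unique.
by apply: DiffDef => //; apply/diff_locallyP; rewrite dE.
Qed.

Lemma halfline_hderive (f : R -> R) : hsmooth f -> halfline_diff f (hderive f).
Proof.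
move=> hf V rho drho y rho0 hrho; set r := rho y; set L := hderive f r.
(* The affine extension to negative arguments makes [f] differentiable at [r] even if
   [r = 0]. *)
pose psi s := if 0 <= s then f s else f r + L * (s - r).
have -> : (fun z => f (rho z)) = psi \o rho.
  by apply/funext => z; rewrite /psi /= rho0.
suff h : is_diff r psi (fun v => L * v) by exact: is_diff_compose erefl hrho h.
apply: is_diff_of_bound => e e0.
have hL : dquot f r s @[s --> within [set s | 0 <= s] r^'] --> L by exact: hf 0%N r (rho0 y).
have /cvgrPdist_le/(_ e e0) := hL.
rewrite /within /= near_withinE => h.
have h' : \forall s \near r, s != r -> 0 <= s -> `|L - dquot f r s| <= e by exact: h.
apply: filterS h' => s hs.
have pr : psi r = f r by rewrite /psi rho0.
(* At negative [s] the affine extension has no error; elsewhere the bound is that of the difference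
   quotient within the half-line. *)
rewrite pr /psi; case: ifPn => s0; last first.
  rewrite (_ : _ - _ - _ = 0); last by ring.
  by rewrite normr0 mulr_ge0 // ltW.
have [->|sr] := eqVneq s r; first by rewrite !subrr mulr0 subr0 normr0 mulr0.
have sr0 : s - r != 0 by rewrite subr_eq0.
have -> : f s - f r - L * (s - r) = - ((L - dquot f r s) * (s - r)).
  by rewrite /dquot; field.
by rewrite normrN normrM ler_wpM2r // hs.
Qed.

Lemma hsmooth_hderive (f : R -> R) : hsmooth f -> hsmooth (hderive f).
Proof. by move=> hf j r r0; have := hf j.+1 r r0; rewrite iterSr. Qed.

Lemma halfline_mul (f f' g g' : R -> R) : halfline_diff f f' -> halfline_diff g g' ->
  halfline_diff (fun r => f r * g r) (fun r => f' r * g r + f r * g' r).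
Proof.
move=> hf hg V rho drho y rho0 hrho.
apply: is_diff_eq (is_diff_mul (hf _ _ _ _ rho0 hrho) (hg _ _ _ _ rho0 hrho)) _.
by apply/funext => v; rewrite mulrDl mulrA mulrAC.
Qed.

Lemma halfline_expR (f f' : R -> R) : halfline_diff f f' ->
  halfline_diff (fun r => expR (2 * f r)) (fun r => 2 * f' r * expR (2 * f r)).
Proof.
move=> hf V rho drho y rho0 hrho.
have h1 := is_diff_mul (is_diff_const (2 : R) y) (hf _ _ _ _ rho0 hrho).
have h2 : is_diff (2 * f (rho y)) (@expR R) (fun v => v *: expR (2 * f (rho y))).
  have [d1 d2] := is_derive_expR (2 * f (rho y)).
  have d3 : differentiable (@expR R) (2 * f (rho y)) by exact/derivable1_diffP.
  apply: DiffDef => //; rewrite diff1E //; apply/funext => v.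
  by rewrite derive1E d2.
apply: is_diff_eq (is_diff_compose (f := fun z => 2 * f (rho z)) erefl h1 h2) _.
by apply/funext => v /=; rewrite -[LHS]/(_ * _); ring.
Qed.

(** Existence suffices: at the zero section this derivative is multiplied by the vanishing
    differential of [r]. *)
Lemma halfline_expR2 (f f' f'' : R -> R) : halfline_diff f f' -> halfline_diff f' f'' ->
  exists g, halfline_diff (fun r => 2 * f' r * expR (2 * f r)) g.
Proof.
move=> hf hf'.
have hc : halfline_diff (fun _ => 2 : R) (fun _ => 0).
  move=> V rho drho y rho0 hrho; apply: is_diff_eq (is_diff_const _ _) _.
  by apply/funext => v; rewrite mul0r.
by eexists; exact: halfline_mul (halfline_mul hc hf') (halfline_expR hf).
Qed.

End Halfline.

(** * The curvature at the zero section *)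

Lemma koszul_of_near {R : realType} m (g g' : 'rV[R]_m -> 'rV[R]_m -> 'rV[R]_m -> R) y :
  (forall a b, \forall z \near y, g' a b z = g a b z) ->
  (forall a b, differentiable (g' a b) y) ->
  forall c a b, koszul_of g c a b y = koszul_of g' c a b y.
Proof.
move=> E dg c a b.
have h p q v : 'd (g p q) y v = 'd (g' p q) y v by exact: near_diff (E p q) (dg p q) v.
exact: (congr1 (fun t => 2^-1 * t) (congr2 (fun s t => s - t)
  (congr2 (fun s t => s + t) (h a b c) (h c b a)) (h c a b))).
Qed.

Section Curvature.
Context {R : realType} {n k : nat} {M : manifold R n}.
Variables (gM : forall x : M, tangent x -> tangent x -> R)
  (hgM : is_metric (V := tangent_family M) gM)
  (nablaM : connection (tangent_family M)) (hnablaM : is_levi_civita gM nablaM)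
  (RM : forall x : M, tangent x -> tangent x -> tangent x -> tangent x)
  (hRM : is_curvature nablaM RM)
  (E : vbundle k M)
  (gE : forall x : M, fib E x -> fib E x -> R)
  (hgE : is_metric (V := bundle_family E) gE)
  (DE : connection (bundle_family E)) (hDE : is_connection DE)
  (hDEgE : metric_compatible (V := bundle_family E) gE DE)
  (RE : forall x : M, tangent x -> tangent x -> fib E x -> fib E x)
  (hRE : is_curvature DE RE)
  (phi1 phi2 : R -> R) (hphi1 : hsmooth phi1) (hphi2 : hsmooth phi2)
  (nabla : connection (tangent_family (total_space E)))
  (hnabla : is_levi_civita (total_metric DE gM gE phi1 phi2) nabla)
  (RT : forall e : total_space E, tangent e -> tangent e -> tangent e -> tangent e)
  (hRT : is_curvature nabla RT).
Variables (t : ltriv (fib E) k) (c : chart R n M) (d : chart R (n + k) (total_space E)).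
Hypotheses (ht : trivs t) (ac : atlas c) (ad : atlas d)
  (dd : cdom d = [set e | cdom c (tag (unpt e)) /\ tdom t (tag (unpt e))])
  (dE : forall x (u : fib E x), cdom c x -> tdom t x ->
     cmap d (pt (existT _ x u)) = row_mx (cmap c x) (tcomp t u)).
Let hc := atlas_chart ac.
Let hd := atlas_chart ad.
Local Notation T := (total_space E).
Local Notation lp := (@lsubmx R 1 n k).
Local Notation rp := (@rsubmx R 1 n k).
Local Notation G := (fun x a b => metric_coord gM c a b x).
Local Notation H := (fmetric gE t c).
Local Notation A := (conn_coef DE t c).
Local Notation dA := (conn_coef_diff DE t c).
Local Notation f1 := (fun r => expR (2 * phi1 r)).
Local Notation f2 := (fun r => expR (2 * phi2 r)).
Local Notation f1' := (fun r => 2 * hderive phi1 r * expR (2 * phi1 r)).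
Local Notation f2' := (fun r => 2 * hderive phi2 r * expR (2 * phi2 r)).
Local Notation Om := (trivdom t c).
Local Notation g := (total_metric DE gM gE phi1 phi2).
Local Notation tm := (tmetric G H A f1 f2).
Local Notation GK := (koszul_of (metric_coord gM c)).

Let H_sym := fmetric_sym hgE t c.
Let H_lin := fmetric_lin hgE c ht.
Let H_ge0 := fmetric_ge0 hgE t c.
Let A_linl := conn_coef_linl hDE ht ac.
Let A_linr := conn_coef_linr hDE ht ac.
Let A_diff x a q := is_diff_conn_coef hDE ht ac (x := x) a q.
Let H_diff x p q := is_diff_fmetric hgE hDEgE ht ac (x := x) p q.
Let dA_linr := conn_coef_diff_linr hDE ht ac.
Let hf1 := halfline_expR (halfline_hderive hphi1).
Let hf2 := halfline_expR (halfline_hderive hphi2).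

Lemma gM_sym q (u v : tangent q) : gM u v = gM v u.
Proof. by have [h _ _ _] := hgM; exact: h. Qed.

Lemma gM_lin q a (u v w : tangent q) : gM (a *: u + v) w = a * gM u w + gM v w.
Proof. by have [_ h _ _] := hgM; exact: h. Qed.

Lemma gM_smooth q (s s' : vfield M) : smooth_near (V := tangent_family M) q s ->
  smooth_near (V := tangent_family M) q s' -> cdom c q ->
  differentiable ((fun x => gM (s x) (s' x)) \o cinv c) (cmap c q).
Proof.
move=> [U1 [oU1 U1q] h1] [U2 [oU2 U2q] h2] cq; have [_ _ _ h] := hgM.
have oU : open (U1 `&` U2) by exact: openI.
have h1' := vf_smooth_sub (@subIsetl _ U1 U2) h1.
have h2' := vf_smooth_sub (@subIsetr _ U1 U2) h2.
have [h3 _] := h _ s s' oU h1' h2' c ac 1.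
by apply: h3; exact: cimg_cmap.
Qed.

Lemma gM_diff x a b : Om x -> differentiable (fun z => G z a b) x.
Proof.
move=> Ox; have [[cx tx] _ xE] := cimg_cinv hc Ox; rewrite -xE.
apply: (gM_smooth (s := cfield c a) (s' := cfield c b)) => //;
  exact: (cfield_smooth_near ac (fun _ h => h) _ cx).
Qed.

Lemma gM_koszul q a b e : cdom c q -> tdom t q ->
  GK a b e (cmap c q) = gM (nablaM (cfield c a q) (cfield c b)) (cfield c e q).
Proof.
move=> cq tq.
apply: (koszulE hnablaM (U := cdom c `&` tdom t) ac (@subIsetl _ _ _)
  (fun x u v _ => gM_sym u v)); last by split.
by move=> x a' b' [cx tx]; apply: gM_diff; exact: cimg_cmap.
Qed.

(** By Koszul's formula the function is a pairing of smooth fields, one of them a [nablaM]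
    derivative, so the metric need not be differentiated twice. *)
Lemma GK_diff q a b e : cdom c q -> tdom t q -> differentiable (GK a b e) (cmap c q).
Proof.
move=> cq tq; have [hcM _ _] := hnablaM.
have s1 : smooth_near (V := tangent_family M) q (fun x => nablaM (cfield c a x) (cfield c b)).
  exists (cdom c); first by split=> //; exact: open_cdom hc.
  by apply: (conn_smooth hcM) (open_cdom hc) _ _; exact: cfield_smooth.
have s2 := cfield_smooth_near ac (fun _ h => h) e cq.
apply: near_differentiable (gM_smooth s1 s2 cq).
have nU := near_cimg hc cq (open_trivchart ht ac) (conj cq tq).
apply: filterS nU => y iy; have [[cy ty] _ yE] := cimg_cinv hc iy.
by apply: etrans (esym (gM_koszul a b e cy ty)) _; rewrite yE.
Qed.

Lemma trivdom_total q : cdom d q -> Om (lp (cmap d q)).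
Proof.
move=> dq; have [cq tq] := (cdom_total dd q).1 dq.
by rewrite (cmap_total dd dE dq) row_mxKl; exact: cimg_cmap.
Qed.

Lemma metric_coord_total q a b : cdom d q ->
  metric_coord g d a b (cmap d q) = tm a b (cmap d q).
Proof.
move=> dq; rewrite /metric_coord (cmapK hd dq).
apply: etrans (total_metricE hDE gM gE ht ac ad dd dE phi1 phi2 _ _ dq) _.
by rewrite (tcoord_cfield _ ad dq) (tcoord_cfield _ ad dq).
Qed.

Lemma near_metric_coord_total q a b : cdom d q ->
  \forall y \near cmap d q, tm a b y = metric_coord g d a b y.
Proof.
move=> dq; apply: filterS (near_cimg hd dq openT I) => y iy.
have [_ dy yE] := cimg_cinv hd iy.
by have := metric_coord_total a b dy; rewrite yE => ->.
Qed.

Lemma tm_diff q a b : cdom d q -> differentiable (tm a b) (cmap d q).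
Proof.
move=> dq.
have h := is_diff_tmetric (dA := dA) gM_diff H_sym H_lin H_ge0 A_linr A_diff H_diff
  hf1 hf2 a b (trivdom_total dq).
exact: (ex_diff (is_diff_def := h)).
Qed.

Lemma metric_coord_total_diff q a b : cdom d q ->
  differentiable (metric_coord g d a b) (cmap d q).
Proof.
move=> dq; exact: near_differentiable (near_metric_coord_total a b dq) (tm_diff a b dq).
Qed.

Lemma koszul_total q a b e : cdom d q ->
  koszul_of (metric_coord g d) a b e (cmap d q) = koszul_of tm a b e (cmap d q).
Proof.
move=> dq; apply: koszul_of_near => [a' b'|a' b']; last exact: tm_diff.
exact: near_metric_coord_total.
Qed.

Lemma metric_coord_linl q a p p' r : cdom c q ->
  metric_coord gM c (a *: p + p') r (cmap c q) =
  a * metric_coord gM c p r (cmap c q) + metric_coord gM c p' r (cmap c q).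
Proof. by move=> cq; rewrite /metric_coord cfieldD cfieldZ gM_lin. Qed.

Lemma metric_coord_sym p r y : metric_coord gM c p r y = metric_coord gM c r p y.
Proof. exact: gM_sym. Qed.

Lemma total_sym q (u v : tangent q) : cdom d q -> g u v = g v u.
Proof.
move=> dq.
apply: etrans (total_metricE hDE gM gE ht ac ad dd dE phi1 phi2 u v dq) _.
apply: etrans (esym (total_metricE hDE gM gE ht ac ad dd dE phi1 phi2 v u dq)).
by rewrite /tmetric H_sym (metric_coord_sym (lp _)).
Qed.

(** The components behind the total metric are chosen with [xget]; their linearity is visible in
    coordinates, through [vproj]. *)
Lemma total_lin q a (u v w : tangent q) : cdom d q ->
  g (a *: u + v) w = a * g u w + g v w.
Proof.
move=> dq; have [cq tq] := (cdom_total dd q).1 dq.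
apply: etrans (total_metricE hDE gM gE ht ac ad dd dE phi1 phi2 _ w dq) _.
rewrite (total_metricE hDE gM gE ht ac ad dd dE phi1 phi2 u w dq).
rewrite (total_metricE hDE gM gE ht ac ad dd dE phi1 phi2 v w dq).
rewrite tcoordD tcoordZ /tmetric.
have lpE : lp (cmap d q) = cmap c (base q) by rewrite (cmap_total dd dE dq) row_mxKl.
have -> : lp (a *: tcoord d u + tcoord d v) = a *: lp (tcoord d u) + lp (tcoord d v).
  by rewrite linearP.
have -> : vproj A (a *: tcoord d u + tcoord d v) (cmap d q)
    = a *: vproj A (tcoord d u) (cmap d q) + vproj A (tcoord d v) (cmap d q).
  rewrite /vproj !linearP /= A_linl.
  by apply/rowP => i; rewrite !mxE; ring.
rewrite (H_Dl H_sym H_lin) (H_Zl H_sym H_lin) lpE metric_coord_linl //.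
by ring.
Qed.

(** * Evaluation at a point of the zero section *)

Variables (o : T).
Hypotheses (hdo : cdom d o) (ho : fvec o = 0).
Local Notation x0 := (cmap c (base o)).
Let co : cdom c (base o) := ((cdom_total dd o).1 hdo).1.
Let to : tdom t (base o) := ((cdom_total dd o).1 hdo).2.
Let Uo : (cdom c `&` tdom t) (base o) := conj co to.
Let Ox0 : Om x0 := cimg_cmap Uo co.

Lemma lp_zero : lp (cmap d o) = x0.
Proof. by rewrite (cmap_total dd dE hdo) row_mxKl. Qed.

Lemma rp_zero : rp (cmap d o) = 0.
Proof. by rewrite (cmap_total dd dE hdo) row_mxKr ho tcomp0. Qed.

Lemma total_metric_zero (X Y : tangent o) :
  g X Y = f1 0 * metric_coord gM c (lp (tcoord d X)) (lp (tcoord d Y)) x0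
    + f2 0 * H x0 (rp (tcoord d X)) (rp (tcoord d Y)).
Proof.
apply: etrans (total_metricE hDE gM gE ht ac ad dd dE phi1 phi2 X Y hdo) _.
rewrite /tmetric (sqnorm0 H_lin rp_zero) !(vproj0 A_linr rp_zero) lp_zero.
by [].
Qed.

(** Koszul's formula serves twice: on the total space to pass to [tmetric], and on [M] to recognise
    [GK] as a pairing with [nablaM]. *)
Lemma total_conn_zero a b (Z : tangent o) :
  g (nabla (cfield d a o) (cfield d b)) Z =
  f1 0 * metric_coord gM c (tcoord c (nablaM (cfield c (lp a) (base o)) (cfield c (lp b))))
      (lp (tcoord d Z)) x0
  + f2 0 * H x0 (A x0 (lp a) (rp b) + A x0 (lp b) (rp a)) (rp (tcoord d Z)).
Proof.
have h1 := koszulE hnabla ad (fun _ h => h) total_sym metric_coord_total_diff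
  a b (tcoord d Z) hdo.
rewrite (cfieldK Z ad hdo) in h1; rewrite -h1.
apply: etrans (koszul_total a b (tcoord d Z) hdo) _.
have Oy0 : Om (lp (cmap d o)) by rewrite lp_zero.
apply: etrans (koszul_tmetric0 (dA := dA) gM_diff H_sym H_lin H_ge0 A_linr A_diff H_diff
  hf1 hf2 Oy0 rp_zero a b (tcoord d Z)) _.
rewrite lp_zero; congr (_ * _ + _).
apply: etrans (gM_koszul (lp a) (lp b) (lp (tcoord d Z)) co to) _.
rewrite -(metric_coordE gM ac _ _ co); congr (metric_coord _ _ _ _ _).
exact: tcoord_cfield.
Qed.

(* Covariant derivatives are only known through their pairings with other vectors, so
   the previous formula is applied to both factors in turn. *)
Lemma total_conn_pair a b a' b' :
  g (nabla (cfield d a o) (cfield d b)) (nabla (cfield d a' o) (cfield d b')) =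
  f1 0 * gM (nablaM (cfield c (lp a) (base o)) (cfield c (lp b)))
            (nablaM (cfield c (lp a') (base o)) (cfield c (lp b')))
  + f2 0 * H x0 (A x0 (lp a) (rp b) + A x0 (lp b) (rp a))
                (A x0 (lp a') (rp b') + A x0 (lp b') (rp a')).
Proof.
set w := nabla (cfield d a o) _; set w' := nabla (cfield d a' o) _.
(* [N] has the components that [total_conn_zero] predicts for [w'], so it has the same pairings and
   can replace [w']. *)
pose N : tangent o := cfield d (row_mx
  (tcoord c (nablaM (cfield c (lp a') (base o)) (cfield c (lp b'))))
  (A x0 (lp a') (rp b') + A x0 (lp b') (rp a'))) o.
have tN : tcoord d N = row_mx
  (tcoord c (nablaM (cfield c (lp a') (base o)) (cfield c (lp b'))))
  (A x0 (lp a') (rp b') + A x0 (lp b') (rp a')) by exact: tcoord_cfield.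
have E1 : g w' w = g N w.
  apply: etrans (total_conn_zero a' b' w) _; apply/esym.
  by apply: etrans (total_metric_zero N w) _; rewrite tN row_mxKl row_mxKr.
apply: etrans (total_sym _ _ hdo) _; apply: etrans E1 _.
apply: etrans (total_sym _ _ hdo) _; apply: etrans (total_conn_zero a b N) _.
by rewrite tN row_mxKl row_mxKr -(metric_coordE gM ac _ _ co).
Qed.

(** [RT] and [RM] are both expanded by [curvature_koszul]. The base expansion times [f1 0] absorbs
    [dGK] and the [gM] products; [koszul_deriv_antisym] evaluates the rest. *)
Lemma total_curvature_coord a b e f :
  g (RT (cfield d a o) (cfield d b o) (cfield d e o)) (cfield d f o) =
  f1 0 * gM (RM (cfield c (lp a) (base o)) (cfield c (lp b) (base o)) (cfield c (lp e) (base o)))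
            (cfield c (lp f) (base o))
  + curvature_formula G H A dA f1' f2 f2' (cmap d o) a b e f.
Proof.
(* Bookkeeping over scalars: [K] stands for Koszul derivatives on the total space, [d] for those on
   [M], [q] and [s] for base and fibre pairings of first derivatives. *)
have alg (F1 F2 K1 K2 q1 q2 d1 d2 s1 s2 C : R) :
    K1 - K2 - F2 * s1 + F2 * s2 = F1 * (d1 - d2) + C ->
    K1 - K2 - (F1 * q1 + F2 * s1) + (F1 * q2 + F2 * s2) = F1 * (d1 - d2 - q1 + q2) + C.
  by move=> h; lra.
have Oy0 : Om (lp (cmap d o)) by rewrite lp_zero.
have [f1'' hf1'] := halfline_expR2 (halfline_hderive hphi1)
  (halfline_hderive (hsmooth_hderive hphi1)).
have [f2'' hf2'] := halfline_expR2 (halfline_hderive hphi2)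
  (halfline_hderive (hsmooth_hderive hphi2)).
pose dGK p q r : 'rV[R]_n -> R := 'd (GK p q r) x0.
have hGK p q r : is_diff (lp (cmap d o)) (GK p q r) (dGK p q r).
  by rewrite lp_zero; exact/differentiableP/GK_diff.
have dA_diff p q v : differentiable (fun z => dA z p q v) (lp (cmap d o)).
  by apply: conn_coef_diff_differentiable.
have dK p q r : is_diff (cmap d o) (koszul_of (metric_coord g d) p q r)
    (koszul_deriv G H A dA f1 f1' f2 f2' (cmap d o) dGK p q r).
  have ne : \forall y \near cmap d o, koszul_of tm p q r y = koszul_of (metric_coord g d) p q r y.
    apply: filterS (near_cimg hd hdo openT I) => y iy.
    have [_ dy yE] := cimg_cinv hd iy.
    by have := koszul_total p q r dy; rewrite yE => ->.
  apply: is_diff_near ne _.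
  exact: (is_diff_koszul_tmetric (open_trivdom ht ac) gM_diff H_sym H_lin H_ge0 A_linr
    A_diff H_diff hf1 hf1' hf2 hf2' dA_linr Oy0 rp_zero dA_diff hGK p q r).
have h1 := curvature_koszul hnabla hRT ad (open_cdom hd) (fun _ h => h) total_sym total_lin
  metric_coord_total_diff a b e f hdo (fun p q r => ex_diff (is_diff_def := dK p q r)).
have h2 := curvature_koszul hnablaM hRM ac (open_trivchart ht ac) (@subIsetl _ _ _)
  (fun x u v _ => gM_sym u v) (fun x s u v w _ => gM_lin s u v w)
  (fun x p q Ux => gM_diff p q (cimg_cmap Ux Ux.1)) (lp a) (lp b) (lp e) (lp f) Uo
  (fun p q r => GK_diff p q r co to).
have h3 := koszul_deriv_antisym G dA H_sym H_lin A_linr f1 f1' f2 f2' (cmap d o) dGK a b e f.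
have k1 := is_diffE (dK b e f) a.
have k2 := is_diffE (dK a e f) b.
apply: etrans h1 _.
apply: etrans (congr2 (fun s t => s + t) (congr2 (fun s t => s - t)
  (congr2 (fun s t => s - t) k1 k2) (total_conn_pair b e a f))
  (total_conn_pair a e b f)) _.
rewrite /= lp_zero in h3.
have h2' : gM (RM (cfield c (lp a) (base o)) (cfield c (lp b) (base o)) (cfield c (lp e) (base o)))
    (cfield c (lp f) (base o)) =
  dGK (lp b) (lp e) (lp f) (lp a) - dGK (lp a) (lp e) (lp f) (lp b)
  - gM (nablaM (cfield c (lp b) (base o)) (cfield c (lp e)))
       (nablaM (cfield c (lp a) (base o)) (cfield c (lp f)))
  + gM (nablaM (cfield c (lp a) (base o)) (cfield c (lp e)))
       (nablaM (cfield c (lp b) (base o)) (cfield c (lp f))) by exact: h2.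
rewrite h2'.
exact: alg h3.
Qed.

Lemma tcoord_hpart_zero (X : tangent o) :
  tcoord d (hpart DE X) = row_mx (lp (tcoord d X)) 0.
Proof.
rewrite (tcoord_hpart hDE ht ac ad dd dE X hdo) (vproj0 A_linr rp_zero).
by rewrite -[X in X - _]hsubmxK opp_row_mx add_row_mx oppr0 addr0 subrr.
Qed.

Lemma tcoord_vpart_zero (X : tangent o) :
  tcoord d (vpart DE X) = row_mx 0 (rp (tcoord d X)).
Proof.
by rewrite (tcoord_vpart hDE ht ac ad dd dE X hdo) (vproj0 A_linr rp_zero).
Qed.

Lemma hcompE (X : tangent o) : hcomp DE X = cfield c (lp (tcoord d X)) (base o).
Proof.
by rewrite -(tcoord_hcomp hDE ht ac ad dd dE X hdo) (cfieldK _ ac co).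
Qed.

Lemma tcomp_vcomp_zero (X : tangent o) : tcomp t (vcomp DE X) = rp (tcoord d X).
Proof.
by rewrite (tcoord_vcomp hDE ht ac ad dd dE X hdo) (vproj0 A_linr rp_zero).
Qed.

Lemma pairM_zero (X Y : tangent o) :
  gM (hcomp DE X) (hcomp DE Y) = metric_coord gM c (lp (tcoord d X)) (lp (tcoord d Y)) x0.
Proof. by rewrite !hcompE /metric_coord (cmapK hc co). Qed.

Lemma pairE_zero (X Y : tangent o) :
  gE (vcomp DE X) (vcomp DE Y) = H x0 (rp (tcoord d X)) (rp (tcoord d Y)).
Proof. by rewrite (fmetricE gE ht ac _ _ Uo) !tcomp_vcomp_zero. Qed.

Lemma curvatureE_zero (X Y Z W : tangent o) :
  gE (RE (hcomp DE X) (hcomp DE Y) (vcomp DE Z)) (vcomp DE W) =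
  H x0 (curv A dA x0 (lp (tcoord d X)) (lp (tcoord d Y)) (rp (tcoord d Z)))
     (rp (tcoord d W)).
Proof.
apply: etrans (fmetricE gE ht ac _ _ Uo) _.
have hX := tcoord_hcomp hDE ht ac ad dd dE X hdo.
have hY := tcoord_hcomp hDE ht ac ad dd dE Y hdo.
have hR := curvature_triv hDE hRE ht ac (hcomp DE X) (hcomp DE Y) (vcomp DE Z) Uo.
have hC := etrans (congr1 (fun p => curv A dA x0 p _ _) hX)
  (etrans (congr1 (fun p => curv A dA x0 _ p _) hY)
    (congr1 (fun p => curv A dA x0 _ _ p) (tcomp_vcomp_zero Z))).
exact: (congr2 (H x0) (etrans hR hC) (tcomp_vcomp_zero W)).
Qed.

Lemma total_curvature_zero (X Y Z W : tangent o) :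
  g (RT X Y Z) W =
  f1 0 * gM (RM (hcomp DE X) (hcomp DE Y) (hcomp DE Z)) (hcomp DE W)
  + curvature_formula G H A dA f1' f2 f2' (cmap d o)
      (tcoord d X) (tcoord d Y) (tcoord d Z) (tcoord d W).
Proof.
have := total_curvature_coord (tcoord d X) (tcoord d Y) (tcoord d Z) (tcoord d W).
rewrite (cfieldK X ad hdo) (cfieldK Y ad hdo) (cfieldK Z ad hdo) (cfieldK W ad hdo).
by rewrite -!hcompE.
Qed.

Lemma gM_0r q (u : tangent q) : gM u 0 = 0.
Proof.
by rewrite gM_sym; have := gM_lin (-1) 0 0 u; rewrite scaler0 addr0 mulN1r addNr.
Qed.

Lemma gM_0l q (u : tangent q) : gM 0 u = 0.
Proof. by rewrite gM_sym gM_0r. Qed.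

(** [RM] is known through [is_curvature] alone. For equal fields the second derivatives cancel and
    the bracket is zero; the case [v = 0] settles two vertical arguments. *)
Lemma curvatureM_diag q (v w : tangent q) : cdom c q -> RM v v w = 0.
Proof.
move=> cq; have [hcM _ _] := hnablaM.
have sm a := cfield_smooth_near ac (fun _ h => h) a cq.
have := hRM (sm (tcoord c v)) (sm (tcoord c v)) (sm (tcoord c w)).
rewrite (cfieldK v ac cq) (cfieldK w ac cq) => ->.
rewrite subrr (lie_cfield _ _ ac cq) sub0r.
have := conn_linear hcM (-1) (0 : tangent q) (0 : tangent q) (sm (tcoord c w)).
by rewrite scaler0 add0r scaleN1r addNr => ->; rewrite oppr0.
Qed.

Local Notation CF := (curvature_formula G H A dA f1' f2 f2' (cmap d o)).
Local Notation hT := (hpart DE).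
Local Notation vT := (vpart DE).

Let Oy0 : Om (lp (cmap d o)).
Proof. by rewrite lp_zero. Qed.

Let G_0l p : metric_coord gM c 0 p (lp (cmap d o)) = 0.
Proof.
rewrite lp_zero; have := metric_coord_linl (-1) 0 0 p co.
by rewrite scaler0 addr0 mulN1r addNr.
Qed.

Let G_0r p : metric_coord gM c p 0 (lp (cmap d o)) = 0.
Proof. by rewrite metric_coord_sym G_0l. Qed.

Lemma hcomp_vpart (X : tangent o) : hcomp DE (vT X) = 0.
Proof.
apply: (tcoord_inj ac co).
apply: etrans (tcoord_hcomp hDE ht ac ad dd dE (vT X) hdo) _.
apply: etrans (congr1 lp (tcoord_vpart_zero X)) _.
by rewrite row_mxKl tcoord0.
Qed.

Lemma total_curvature_eq (A' B' C' F' : tangent o) a b e f s :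
  tcoord d A' = a -> tcoord d B' = b -> tcoord d C' = e -> tcoord d F' = f ->
  CF a b e f = s ->
  g (RT A' B' C') F' =
  f1 0 * gM (RM (hcomp DE A') (hcomp DE B') (hcomp DE C')) (hcomp DE F') + s.
Proof. by move=> <- <- <- <- <-; exact: total_curvature_zero. Qed.

Lemma total_curvature_eq0 (A' B' C' F' : tangent o) a b e f s :
  gM (RM (hcomp DE A') (hcomp DE B') (hcomp DE C')) (hcomp DE F') = 0 ->
  tcoord d A' = a -> tcoord d B' = b -> tcoord d C' = e -> tcoord d F' = f ->
  CF a b e f = s -> g (RT A' B' C') F' = s.
Proof.
move=> r0 ha hb he hf hs; apply: etrans (total_curvature_eq ha hb he hf hs) _.
by rewrite r0 mulr0 add0r.
Qed.

Lemma curvatureM_vpart4 (A' B' C' : tangent (base o)) (W : tangent o) :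
  gM (RM A' B' C') (hcomp DE (vT W)) = 0.
Proof. by apply: etrans (congr1 (gM (RM A' B' C')) (hcomp_vpart W)) _; exact: gM_0r. Qed.

Lemma curvatureM_vpart12 (X Y : tangent o) (C' F' : tangent (base o)) :
  gM (RM (hcomp DE (vT X)) (hcomp DE (vT Y)) C') F' = 0.
Proof.
apply: etrans (congr2 (fun u v => gM (RM u v C') F') (hcomp_vpart X) (hcomp_vpart Y)) _.
by apply: etrans (congr1 (fun u => gM u F') (curvatureM_diag 0 C' co)) _; exact: gM_0l.
Qed.

Variables (X Y Z W : tangent o).
Let hX := tcoord_hpart_zero X.
Let hY := tcoord_hpart_zero Y.
Let hZ := tcoord_hpart_zero Z.
Let hW := tcoord_hpart_zero W.
Let vX := tcoord_vpart_zero X.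
Let vY := tcoord_vpart_zero Y.
Let vZ := tcoord_vpart_zero Z.
Let vW := tcoord_vpart_zero W.

(** The theorem applies [hcomp] and [vcomp] to parts already projected; at the zero section these
    keep the relevant coordinates of the original vector. *)
Let lph (U : tangent o) : lp (tcoord d (hT U)) = lp (tcoord d U).
Proof. by apply: etrans (congr1 lp (tcoord_hpart_zero U)) _; rewrite row_mxKl. Qed.

Let rpv (U : tangent o) : rp (tcoord d (vT U)) = rp (tcoord d U).
Proof. by apply: etrans (congr1 rp (tcoord_vpart_zero U)) _; rewrite row_mxKr. Qed.

Lemma curvatureE_parts (U1 U2 U3 U4 : tangent o) :
  gE (RE (hcomp DE (hT U1)) (hcomp DE (hT U2)) (vcomp DE (vT U3))) (vcomp DE (vT U4)) =
  H (lp (cmap d o)) (curv A dA (lp (cmap d o)) (lp (tcoord d U1)) (lp (tcoord d U2))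
     (rp (tcoord d U3))) (rp (tcoord d U4)).
Proof.
apply: etrans (curvatureE_zero (hT U1) (hT U2) (vT U3) (vT U4)) _.
apply: etrans (congr1 (fun z => H z (curv A dA z _ _ _) _) (esym lp_zero)) _.
apply: congr2 (rpv U4).
apply: etrans (congr1 (fun p => curv A dA _ p _ _) (lph U1)) _.
apply: etrans (congr1 (fun p => curv A dA _ _ p _) (lph U2)) _.
exact: (congr1 (fun p => curv A dA _ _ _ p) (rpv U3)).
Qed.

Lemma pairE_parts (U1 U2 : tangent o) :
  gE (vcomp DE (vT U1)) (vcomp DE (vT U2)) =
  H (lp (cmap d o)) (rp (tcoord d U1)) (rp (tcoord d U2)).
Proof.
apply: etrans (pairE_zero (vT U1) (vT U2)) _.
apply: etrans (congr1 (fun z => H z _ _) (esym lp_zero)) _.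
exact: (congr2 (H _) (rpv U1) (rpv U2)).
Qed.

Lemma pairM_parts (U1 U2 : tangent o) :
  gM (hcomp DE (hT U1)) (hcomp DE (hT U2)) =
  metric_coord gM c (lp (tcoord d U1)) (lp (tcoord d U2)) (lp (cmap d o)).
Proof.
apply: etrans (pairM_zero (hT U1) (hT U2)) _.
apply: etrans (congr1 (fun z => metric_coord gM c _ _ z) (esym lp_zero)) _.
exact: (congr2 (fun p q => metric_coord gM c p q _) (lph U1) (lph U2)).
Qed.

Lemma total_curvature_hhhh : g (RT (hT X) (hT Y) (hT Z)) (hT W) =
  f1 0 * gM (RM (hcomp DE (hT X)) (hcomp DE (hT Y)) (hcomp DE (hT Z))) (hcomp DE (hT W)).
Proof.
have CFE := curvature_formula_hhhh G H_sym H_lin A_linr A_diff f1' f2 f2' Oy0.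
by apply: etrans (total_curvature_eq hX hY hZ hW (CFE _ _ _ _)) _; exact: addr0.
Qed.

Lemma total_curvature_hhhv : g (RT (hT X) (hT Y) (hT Z)) (vT W) = 0.
Proof.
have CFE := curvature_formula_hhhv G H_sym H_lin A_linr A_diff f1' f2 f2' Oy0.
exact: (total_curvature_eq0 (curvatureM_vpart4 _ _ _ _) hX hY hZ vW (CFE _ _ _ _)).
Qed.

Lemma total_curvature_hhvv : g (RT (hT X) (hT Y) (vT Z)) (vT W) =
  f2 0 * gE (RE (hcomp DE (hT X)) (hcomp DE (hT Y)) (vcomp DE (vT Z))) (vcomp DE (vT W)).
Proof.
have CFE := curvature_formula_hhvv G H_sym H_lin A_linr A_diff f1' f2 f2' Oy0.
apply: etrans (total_curvature_eq0 (curvatureM_vpart4 _ _ _ _) hX hY vZ vW (CFE _ _ _ _)) _.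
exact: (congr1 (fun s => f2 0 * s) (esym (curvatureE_parts X Y Z W))).
Qed.

Lemma total_curvature_hvhv : g (RT (hT X) (vT Y) (hT Z)) (vT W) =
  f1' 0 * gM (hcomp DE (hT X)) (hcomp DE (hT Z)) * gE (vcomp DE (vT Y)) (vcomp DE (vT W))
  + 2^-1 * f2 0 * gE (RE (hcomp DE (hT X)) (hcomp DE (hT Z)) (vcomp DE (vT Y))) (vcomp DE (vT W)).
Proof.
have CFE := curvature_formula_hvhv G H_sym H_lin A_linl A_linr A_diff f1' f2 f2' Oy0.
apply: etrans (total_curvature_eq0 (curvatureM_vpart4 _ _ _ _) hX vY hZ vW (CFE _ _ _ _)) _.
apply: congr2; last exact: (congr1 (fun s => 2^-1 * f2 0 * s) (esym (curvatureE_parts X Z Y W))).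
exact: (congr2 (fun s s' => f1' 0 * s * s') (esym (pairM_parts X Z)) (esym (pairE_parts Y W))).
Qed.

Lemma total_curvature_vvhh : g (RT (vT X) (vT Y) (hT Z)) (hT W) =
  f2 0 * gE (RE (hcomp DE (hT Z)) (hcomp DE (hT W)) (vcomp DE (vT X))) (vcomp DE (vT Y)).
Proof.
have CFE := curvature_formula_vvhh (open_trivdom ht ac) G H_sym H_lin A_diff H_diff
  f1' f2 f2' Oy0.
apply: etrans (total_curvature_eq0 (curvatureM_vpart12 _ _ _ _) vX vY hZ hW (CFE _ _ _ _)) _.
exact: (congr1 (fun s => f2 0 * s) (esym (curvatureE_parts Z W X Y))).
Qed.

Lemma total_curvature_vvvh : g (RT (vT X) (vT Y) (vT Z)) (hT W) = 0.
Proof.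
have CFE := curvature_formula_vvvh (G := G) H_sym H_lin A_linl A_linr A_diff f1' f2 f2' Oy0 G_0l.
exact: (total_curvature_eq0 (curvatureM_vpart12 _ _ _ _) vX vY vZ hW (CFE _ _ _ _)).
Qed.

Lemma total_curvature_hvvv : g (RT (hT X) (vT Y) (vT Z)) (vT W) = 0.
Proof.
have CFE := curvature_formula_hvvv (G := G) H_sym H_lin A_linl A_linr A_diff f1' f2 f2' Oy0 G_0r.
exact: (total_curvature_eq0 (curvatureM_vpart4 _ _ _ _) hX vY vZ vW (CFE _ _ _ _)).
Qed.

(** [f2' 0] is [b] times [f2 0]; the minus sign comes from listing the two products in the opposite
    order. *)
Lemma total_curvature_vvvv : g (RT (vT X) (vT Y) (vT Z)) (vT W) =
  - 2 * (2 * hderive phi2 0) * f2 0 *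
    (gE (vcomp DE (vT X)) (vcomp DE (vT W)) * gE (vcomp DE (vT Y)) (vcomp DE (vT Z))
     - gE (vcomp DE (vT X)) (vcomp DE (vT Z)) * gE (vcomp DE (vT Y)) (vcomp DE (vT W))).
Proof.
have CFE := curvature_formula_vvvv (G := G) H_sym H_lin A_linl A_linr A_diff f1' f2 f2' Oy0 G_0l.
apply: etrans (total_curvature_eq0 (curvatureM_vpart4 _ _ _ _) vX vY vZ vW (CFE _ _ _ _)) _.
apply: etrans _ (congr2 (fun s s' => - 2 * (2 * hderive phi2 0) * f2 0 * (s - s'))
  (congr2 (fun s s' => s * s') (esym (pairE_parts X W)) (esym (pairE_parts Y Z)))
  (congr2 (fun s s' => s * s') (esym (pairE_parts X Z)) (esym (pairE_parts Y W)))).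
rewrite (H_sym _ (rp (tcoord d Z)) (rp (tcoord d X))).
rewrite (H_sym _ (rp (tcoord d W)) (rp (tcoord d X))).
by ring.
Qed.

End Curvature.

Theorem theorem2p1 (R : realType) (n k : nat)
  (M : manifold R n)
  (gM : forall x : M, tangent x -> tangent x -> R)
  (hgM : is_metric (V := tangent_family M) gM)
  (nablaM : connection (tangent_family M))
  (hnablaM : is_levi_civita gM nablaM)
  (RM : forall x : M, tangent x -> tangent x -> tangent x -> tangent x)
  (hRM : is_curvature nablaM RM)
  (E : vbundle k M)
  (gE : forall x : M, fib E x -> fib E x -> R)
  (hgE : is_metric (V := bundle_family E) gE)
  (DE : connection (bundle_family E))
  (hDE : is_connection DE)
  (hDEgE : metric_compatible (V := bundle_family E) gE DE)
  (RE : forall x : M, tangent x -> tangent x -> fib E x -> fib E x)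
  (hRE : is_curvature DE RE)
  (phi1 phi2 : R -> R) (hphi1 : hsmooth phi1) (hphi2 : hsmooth phi2)
  (nabla : connection (tangent_family (total_space E)))
  (hnabla : is_levi_civita (total_metric DE gM gE phi1 phi2) nabla)
  (RT : forall e : total_space E, tangent e -> tangent e -> tangent e -> tangent e)
  (hRT : is_curvature nabla RT)
  (o : total_space E) (ho : zero_section o) (X Y Z W : tangent o) :
  let x : M := base o in
  let Ro (A B C F : tangent o) : R :=
    total_metric DE gM gE phi1 phi2 (RT o A B C) F in
  let Xh := hpart DE X in let Xv := vpart DE X in
  let Yh := hpart DE Y in let Yv := vpart DE Y in
  let Zh := hpart DE Z in let Zv := vpart DE Z in
  let Wh := hpart DE W in let Wv := vpart DE W in
  let h := @hcomp R n k M E DE o in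
  let v := @vcomp R n k M E DE o in
  let inM := @pairM R n k M E DE gM o in
  let inE := @pairE R n k M E DE gE o in
  let a := 2 * hderive phi1 0 in
  let b := 2 * hderive phi2 0 in
  let e1 := expR (2 * phi1 0) in
  let e2 := expR (2 * phi2 0) in
  Ro Xh Yh Zh Wh = e1 * gM x (RM x (h Xh) (h Yh) (h Zh)) (h Wh) /\
  Ro Xh Yh Zh Wv = 0 /\
  Ro Xh Yh Zv Wv = e2 * gE x (RE x (h Xh) (h Yh) (v Zv)) (v Wv) /\
  Ro Xh Yv Zh Wv = a * e1 * inM Xh Zh * inE Yv Wv
                   + 2^-1 * e2 * gE x (RE x (h Xh) (h Zh) (v Yv)) (v Wv) /\
  Ro Xv Yv Zh Wh = e2 * gE x (RE x (h Zh) (h Wh) (v Xv)) (v Yv) /\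
  Ro Xv Yv Zv Wh = 0 /\
  Ro Xh Yv Zv Wv = 0 /\
  Ro Xv Yv Zv Wv = - 2 * b * e2 * (inE Xv Wv * inE Yv Zv - inE Xv Zv * inE Yv Wv).
Proof.
move=> x Ro Xh Xv Yh Yv Zh Zv Wh Wv h v inM inE a b e1 e2.
(* A trivialisation at the base point and the preferred chart there give a chart of the total space
   around [o]. *)
have [t ht to] := trivs_cover E (base o).
have ac := mchart_atlas (base o); have co := mchart_dom (base o).
have [d [ad dd dE]] := trivs_chart ht ac.
have hdo : cdom d o by rewrite dd.
split; first exact: (total_curvature_hhhh hgM hnablaM hRM hgE hDE hDEgE hphi1 hphi2
  hnabla hRT ht ac ad dd dE hdo ho).
split; first exact: (total_curvature_hhhv hgM hnablaM hRM hgE hDE hDEgE hphi1 hphi2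
  hnabla hRT ht ac ad dd dE hdo ho).
split; first exact: (total_curvature_hhvv hgM hnablaM hRM hgE hDE hDEgE hRE hphi1 hphi2
  hnabla hRT ht ac ad dd dE hdo ho).
split; first exact: (total_curvature_hvhv hgM hnablaM hRM hgE hDE hDEgE hRE hphi1 hphi2
  hnabla hRT ht ac ad dd dE hdo ho).
split; first exact: (total_curvature_vvhh hgM hnablaM hRM hgE hDE hDEgE hRE hphi1 hphi2
  hnabla hRT ht ac ad dd dE hdo ho).
split; first exact: (total_curvature_vvvh hgM hnablaM hRM hgE hDE hDEgE hphi1 hphi2
  hnabla hRT ht ac ad dd dE hdo ho).
split; first exact: (total_curvature_hvvv hgM hnablaM hRM hgE hDE hDEgE hphi1 hphi2
  hnabla hRT ht ac ad dd dE hdo ho).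
exact: (total_curvature_vvvv hgM hnablaM hRM hgE hDE hDEgE hphi1 hphi2
  hnabla hRT ht ac ad dd dE hdo ho).
Qed.
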